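(* Let $R$ be a rectangle with $\mathrm{Area}(R)=A$ and let $A_1,\dots,A_n>0$ be a list of areas with $\sum_{i=1}^n A_i=A$. Then the algorithm ApproximationDC, applied to $R$ and $L=\{A_1,\dots,A_n\}$, constructs a partition of $R$ into $n$ sub-rectangles $R_1,\dots,R_n$ with areas $A_1,\dots,A_n$ that is a factor $1.203$-approximation for the minimum total partition perimeter; that is, $$\sum_{i=1}^n \mathrm{Perim}(R_i)\;\le\;1.203\cdot \sum_{i=1}^n \mathrm{Perim}(S_i)$$ for every partition of $R$ into sub-rectangles $S_1,\dots,S_n$ with $\mathrm{Area}(S_i)=A_i$ for all $i$.
   Context: Rectangles are axis-parallel, and a partition of a rectangle $R$ into sub-rectangles is a collection of sub-rectangles with pairwise disjoint interiors whose union is $R$. For a rectangle $Q$, the perimeter is defined as $\mathrm{Perim}(Q)=\mathrm{width}(Q)+\mathrm{height}(Q)$. Algorithm ApproximationDC$(R,L)$. Input: a rectangle $R$ and a list $L$ of $n\ge 1$ positive areas with sum $\mathrm{Area}(R)$. Sort $L$ in non-increasing order and call Partition$(R,L)$. Partition$(Q,\Lambda)$, where $\Lambda$ is a list of areas, sorted in non-increasing order, with sum $\mathrm{Area}(Q)$: (1) If $\Lambda$ has a single area, return $Q$ as the rectangle assigned to that area. (2) Otherwise regard each area of $\Lambda$ as a singleton block; the area of a block is the sum of the areas in it. Keep the list of blocks sorted by block area in non-increasing order. While there are more than two blocks, merge the two blocks of smallest area (the last two in the list) into one block (their union) and re-insert it so that the list stays sorted. When exactly two blocks $\Lambda_1,\Lambda_2$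 remain, with areas $a_1\ge a_2$: if $\mathrm{width}(Q)>\mathrm{height}(Q)$, divide $Q$ by a vertical line into $Q_1$ (left, area $a_1$) and $Q_2$ (right, area $a_2$); otherwise divide $Q$ by a horizontal line into $Q_1$ (top, area $a_1$) and $Q_2$ (bottom, area $a_2$). Return Partition$(Q_1,\Lambda_1)\,\cup\,$Partition$(Q_2,\Lambda_2)$. *)

(* Defs.v *)
From HB Require Import structures.
From mathcomp Require Import all_boot all_order all_algebra.
From mathcomp Require Import all_classical all_reals all_analysis.
Set Implicit Arguments.
Unset Strict Implicit.
Unset Printing Implicit Defensive.
Import Order.TTheory GRing.Theory Num.Theory.
Import numFieldNormedType.Exports.
Local Open Scope classical_set_scope.
Local Open Scope ring_scope.

Record rect (R : realType) := Rect {
  left : R;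
  right : R;
  bottom : R;
  top : R;
  left_lt_right : left < right;
  bottom_lt_top : bottom < top }.

Section Rectangles.
Variable R : realType.
Implicit Types Q : rect R.

Definition width Q : R := right Q - left Q.

Definition height Q : R := top Q - bottom Q.

Definition area Q : R := width Q * height Q.

Definition perim Q : R := width Q + height Q.

Definition points Q : set (R * R) :=
  `[left Q, right Q] `*` `[bottom Q, top Q].

Definition is_partition (I : Type) Q (S : I -> rect R) : Prop :=
  \bigcup_i points (S i) = points Q /\
  trivIset [set: I] (fun i => (points (S i))°).

Definition vertical_cut Q Ql Qr : Prop :=
  [/\ left Ql = left Q, right Ql = left Qr, right Qr = right Q,
      bottom Ql = bottom Q /\ top Ql = top Q &
      bottom Qr = bottom Q /\ top Qr = top Q].

Definition horizontal_cut Q Qt Qb : Prop :=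
  [/\ top Qt = top Q, bottom Qt = top Qb, bottom Qb = bottom Q,
      left Qt = left Q /\ right Qt = right Q &
      left Qb = left Q /\ right Qb = right Q].

Definition divide Q Q1 Q2 : Prop :=
  if height Q < width Q then vertical_cut Q Q1 Q2 else horizontal_cut Q Q1 Q2.

End Rectangles.

(* The areas are named by indices in [I], so that equal areas stay apart: a
   list of areas, and likewise a block, is a sequence of indices.  Sorting and
   merging are relations rather than functions because the algorithm does not
   say how to order equal areas; every way of breaking ties is allowed. *)
Section Algorithm.
Variables (R : realType) (I : eqType) (A : I -> R).
Implicit Types (s b c : seq I) (bs : seq (seq I)).

Definition block_area b : R := \sum_(i <- b) A i.

Definition sorted_areas s : bool := sorted (fun i j => A j <= A i) s.

Definition sorted_blocks bs : bool :=
  sorted (fun b c => block_area c <= block_area b) bs.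

(* [bs1 ++ bs2 ++ [:: b1; b2]] is the current list of blocks; the union [c] of
   its last two blocks is re-inserted between [bs1] and [bs2]. *)
Inductive merge_blocks : seq (seq I) -> seq I -> seq I -> Prop :=
| MergeDone b1 b2 : merge_blocks [:: b1; b2] b1 b2
| MergeStep bs1 bs2 b1 b2 c s1 s2 :
    (0 < size (bs1 ++ bs2))%N ->
    perm_eq c (b1 ++ b2) -> sorted_areas c ->
    sorted_blocks (bs1 ++ c :: bs2) ->
    merge_blocks (bs1 ++ c :: bs2) s1 s2 ->
    merge_blocks (bs1 ++ bs2 ++ [:: b1; b2]) s1 s2.

(* [Partition f Q s]: some execution of the recursive procedure on the
   rectangle [Q] and the list [s] assigns [f i] to each [i] in [s]; the values
   of [f] outside [s] are irrelevant. *)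
Inductive Partition (f : I -> rect R) : rect R -> seq I -> Prop :=
| PartitionSingle Q i : f i = Q -> Partition f Q [:: i]
| PartitionSplit Q Q1 Q2 s s1 s2 :
    merge_blocks [seq [:: i] | i <- s] s1 s2 ->
    divide Q Q1 Q2 ->
    area Q1 = block_area s1 -> area Q2 = block_area s2 ->
    Partition f Q1 s1 -> Partition f Q2 s2 ->
    Partition f Q s.

End Algorithm.

Definition ApproximationDC (R : realType) (n : nat) (A : 'I_n -> R)
    (Q : rect R) (f : 'I_n -> rect R) : Prop :=
  exists s : seq 'I_n,
    [/\ perm_eq s (enum 'I_n), sorted_areas A s & Partition A f Q s].

(* Main.v *)
(** Measured against the trivial lower bound [2 * sqrt a] for a piece of area [a],
   a rectangle of aspect ratio at most 3 costs a factor [2 / sqrt 3 < 1.155].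
   In the merging tree a block is at most twice as large as its sibling unless
   it is a single area [a] dominating the rest [E] of its parent
   ([a > 2 * area E]), so only dominating areas create thin rectangles; and
   every area outside such a parent is at least [a].  The wall between [a] and
   [E] is paid for by the slack of the large pieces around it; three equal
   areas together with a vanishing one in a square give the worst ratio
   [25 / (12 * sqrt 3) < 1.203].

   When at most two areas lie outside [E], the optimum is bounded from below
   more carefully: in any partition the rectangles of these large areas leave
   only narrow strips, so every rectangle of [E] has a side at most as long as
   the short side of the strip which the algorithm gives to [E], or else the
   two large rectangles are stacked across the short side, which is expensive. *)

Require Import Defs.
From mathcomp Require Import all_boot all_order all_algebra.
From mathcomp Require Import all_classical all_reals all_analysis.
From mathcomp Require Import zify ring lra.
Import Defs.
Set Implicit Arguments.
Unset Strict Implicit.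
Unset Printing Implicit Defensive.
Import Order.TTheory GRing.Theory Num.Theory.
Import numFieldNormedType.Exports.
Local Open Scope ring_scope.

(** * Blocks of the merging procedure *)

(** The tree of merges is never built. All that the cost analysis takes from the merging is
    [sibling], a relation kept between any two blocks of the current list; domination then becomes
    the property [gap] of the list of areas alone.

    The obstacle is that dominating areas may be nested inside the rest [E], and one wall per level
    must not accumulate. Two error terms are used that reproduce themselves under a further
    dominating area. In [thin_bound], measured against [2 * sqrt a], the error is the excess of one
    undivided rectangle plus one wall, whatever the aspect ratio. In [wide_bound] it is [3/5 * q],
    measured against a bound [p] exact on pieces that span a strip of width [q]. The bound [p] stays
    a parameter because the width for which it is sharp changes from one use to another.

    At the root no error is allowed. By [gapped_trichotomy] the error is absorbed unless at most two
    areas lie outside [E]; only there does the relative position of the rectangles of a competing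
    partition enter. *)

Section Huffman.
Variables (R : realType) (I : eqType) (A : I -> R).
Hypothesis A_gt0 : forall i, 0 < A i.
Implicit Types (s b c E : seq I) (bs : seq (seq I)) (t : R).
Local Notation ar := (block_area A).

Lemma block_area_cons i s : ar (i :: s) = A i + ar s.
Proof. by rewrite /block_area big_cons. Qed.

Lemma block_area_seq1 i : ar [:: i] = A i.
Proof. by rewrite /block_area big_seq1. Qed.

Lemma block_area_cat s1 s2 : ar (s1 ++ s2) = ar s1 + ar s2.
Proof. by rewrite /block_area big_cat. Qed.

Lemma perm_block_area s1 s2 : perm_eq s1 s2 -> ar s1 = ar s2.
Proof. by move=> s12; apply: perm_big. Qed.

Lemma block_area_ge0 s : 0 <= ar s.
Proof. by apply: sumr_ge0 => i _; exact: ltW. Qed.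

Lemma block_area_gt0 s : s != [::] -> 0 < ar s.
Proof.
case: s => // i s _; rewrite block_area_cons.
by have := A_gt0 i; have := block_area_ge0 s; lra.
Qed.

Lemma mem_block_area i s : i \in s -> A i <= ar s.
Proof.
move=> /perm_to_rem /perm_block_area ->; rewrite block_area_cons.
by have := block_area_ge0 (rem i s); lra.
Qed.

Definition low_sum t s : R := \sum_(i <- s | A i < t) A i.

(* A dominating area of the merging tree shows up in the list itself: the areas
   below it add up to less than half of it. *)
Definition gap t s : bool :=
  [&& has (fun i => A i < t) s, has (fun i => t <= A i) s & 2 * low_sum t s < t].

Definition gapped s : Prop := exists t, gap t s.

Lemma low_sum_cat t s1 s2 : low_sum t (s1 ++ s2) = low_sum t s1 + low_sum t s2.
Proof. by rewrite /low_sum big_cat. Qed.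

Lemma low_sum_ge0 t s : 0 <= low_sum t s.
Proof. by apply: sumr_ge0 => i _; exact: ltW. Qed.

Lemma low_sum_all t s : all (fun i => A i < t) s -> low_sum t s = ar s.
Proof.
by move=> /allP h; rewrite /low_sum -big_filter; congr block_area; apply/all_filterP/allP.
Qed.

Lemma low_sum_none t s : all (fun i => t <= A i) s -> low_sum t s = 0.
Proof.
move=> /allP h; rewrite /low_sum -big_filter big1_seq // => i.
by rewrite mem_filter => /andP[_ /andP[lt_it /h]]; rewrite leNgt lt_it.
Qed.

Lemma perm_gap t s1 s2 : perm_eq s1 s2 -> gap t s1 = gap t s2.
Proof.
move=> s12; rewrite /gap !(perm_has _ s12); do 2 congr (_ && _).
by rewrite /low_sum (perm_big _ s12).
Qed.

Lemma has_lowN t s : has (fun i => A i < t) s = ~~ all (fun i => t <= A i) s.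
Proof. by rewrite -has_predC; apply: eq_has => i /=; rewrite ltNge. Qed.

Lemma has_highN t s : has (fun i => t <= A i) s = ~~ all (fun i => A i < t) s.
Proof. by rewrite -has_predC; apply: eq_has => i /=; rewrite -leNgt. Qed.

Lemma gap_cons i E : E != [::] -> 2 * ar E < A i -> gap (A i) (i :: E).
Proof.
move=> En0 Ei.
have lowE : all (fun j => A j < A i) E.
  by apply/allP => j jE; have := mem_block_area jE; have := block_area_ge0 E; lra.
rewrite /gap /= ltxx lexx /= -[i :: E]cat1s low_sum_cat.
rewrite (@low_sum_none _ [:: i]) ?(low_sum_all lowE) /= ?lexx // add0r Ei andbT.
by case: E En0 lowE {Ei} => //= j E _ /andP[->].
Qed.

(** What [b] knows about another block [b'] of the current list. When [b] was formed, its two parts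
    were no larger than any other block: this gives the factor 2, and, if the parts were [x] and
    [y :: E], the third clause. By the second clause the areas below a gap of [b] are collected in
    [b] alone. *)
Definition sibling b b' : Prop :=
  [/\ (1 < size b)%N -> ar b <= 2 * ar b',
      forall t, gap t b -> all (fun i => t <= A i) b' &
      forall x y E, perm_eq b (x :: y :: E) -> E != [::] ->
        2 * ar E < A y -> A y <= A x -> A x <= ar b' /\ A y + ar E <= ar b'].

(* Once the part of [b1 ++ b2] below a gap [t] meets a block that also reaches
   above [t], that block carries the gap alone; otherwise the two blocks lie on
   opposite sides of [t]. *)
Lemma gap_cat t b1 b2 : sibling b1 b2 -> sibling b2 b1 -> gap t (b1 ++ b2) ->
  [\/ gap t b1 /\ all (fun i => t <= A i) b2,
      gap t b2 /\ all (fun i => t <= A i) b1,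
      [/\ all (fun i => A i < t) b1, all (fun i => t <= A i) b2, b1 != [::],
          b2 != [::] & 2 * ar b1 < t] |
      [/\ all (fun i => A i < t) b2, all (fun i => t <= A i) b1, b1 != [::],
          b2 != [::] & 2 * ar b2 < t]].
Proof.
move=> [_ s12 _] [_ s21 _] /and3P[hl hh hs].
have := low_sum_ge0 t b1; have := low_sum_ge0 t b2; move: hs.
rewrite low_sum_cat => hs l2 l1.
have g1 : has (fun i => A i < t) b1 -> has (fun i => t <= A i) b1 -> gap t b1.
  by move=> a a'; rewrite /gap a a' /=; lra.
have g2 : has (fun i => A i < t) b2 -> has (fun i => t <= A i) b2 -> gap t b2.
  by move=> a a'; rewrite /gap a a' /=; lra.
have [L1|/negPf L1] := boolP (has (fun i => A i < t) b1).
  have [/(g1 L1) G1|/negPf H1] := boolP (has (fun i => t <= A i) b1).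
    by constructor 1; split=> //; exact: s12.
  have aL1 : all (fun i => A i < t) b1 by move/negbT: H1; rewrite has_highN negbK.
  move: hh; rewrite has_cat H1 /= => H2.
  have [/g2/(_ H2) G2|/negPf L2] := boolP (has (fun i => A i < t) b2).
    by constructor 2; split=> //; exact: s21.
  constructor 3; split=> //.
  - by move/negbT: L2; rewrite has_lowN negbK.
  - by case: (b1) L1.
  - by case: (b2) H2.
  - by rewrite -(low_sum_all aL1); lra.
move: hl; rewrite has_cat L1 /= => L2.
have [/(g2 L2) G2|/negPf H2] := boolP (has (fun i => t <= A i) b2).
  by constructor 2; split=> //; exact: s21.
have aL2 : all (fun i => A i < t) b2 by move/negbT: H2; rewrite has_highN negbK.
move: hh; rewrite has_cat H2 orbF => H1.
constructor 4; split=> //.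
- by move/negbT: L1; rewrite has_lowN negbK.
- by case: (b1) H1.
- by case: (b2) L2.
- by rewrite -(low_sum_all aL2); lra.
Qed.

Lemma all_high_area t s : all (fun i => t <= A i) s -> s != [::] -> t <= ar s.
Proof.
case: s => // i s /= /andP[ti _] _; apply: le_trans ti _.
by apply: mem_block_area; rewrite mem_head.
Qed.

Lemma all_high_single t s :
  s != [::] -> (size s <= 1)%N -> t <= ar s -> all (fun i => t <= A i) s.
Proof. by case: s => [|i []] //= _ _; rewrite block_area_seq1 andbT. Qed.

(* The case of [sibling (b1 ++ b2) b'] in which [b1] carries the gap. *)
Lemma sibling_cat_gap b1 b2 b' x y E :
  perm_eq (b1 ++ b2) (x :: y :: E) -> E != [::] -> 2 * ar E < A y ->
  A y <= A x -> sibling b1 b2 -> b2 != [::] -> gap (A y) b1 ->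
  all (fun i => A y <= A i) b2 -> ar b1 <= ar b' -> ar b2 <= ar b' ->
  A x <= ar b' /\ A y + ar E <= ar b'.
Proof.
move=> pc En0 Ey yx [_ s12 _] b2n0 G1 a2 b1b' b2b'.
have lowE : all (fun j => A j < A y) E.
  by apply/allP => j jE; have := mem_block_area jE; have := block_area_ge0 E; lra.
have lsE : low_sum (A y) b1 = ar E.
  have : low_sum (A y) (b1 ++ b2) = low_sum (A y) (x :: y :: E).
    by rewrite /low_sum (perm_big _ pc).
  rewrite low_sum_cat (low_sum_none a2) addr0 => ->.
  rewrite -[x :: y :: E]/([:: x; y] ++ E) low_sum_cat (low_sum_all lowE).
  by rewrite low_sum_none ?add0r //= yx lexx.
have fE : seq.filter (fun i => A y <= A i) E = [::].
  apply/eqP; rewrite -[_ == _]negbK -has_filter has_highN negbK.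
  exact: lowE.
have pf := perm_filter (fun i => A y <= A i) pc.
move: pf; rewrite filter_cat /= yx lexx fE.
have -> : seq.filter (fun i => A y <= A i) b2 = b2 by apply/all_filterP.
have pb1 : perm_eq b1 ([seq i <- b1 | A y <= A i] ++ [seq i <- b1 | A i < A y]).
  have -> : [seq i <- b1 | A i < A y] = [seq i <- b1 | predC (fun i => A y <= A i) i].
    by apply: seq.eq_filter => i /=; rewrite ltNge.
  by rewrite perm_sym; apply/permPl; exact: perm_filterC.
have arlow : ar [seq i <- b1 | A i < A y] = ar E.
  by rewrite -lsE /low_sum -big_filter.
have arb1 : ar b1 = ar [seq i <- b1 | A y <= A i] + ar E.
  by rewrite (perm_block_area pb1) block_area_cat arlow.
have gx l : [seq i <- b1 | A y <= A i] = [:: l] -> 2 * ar E < A l -> gap (A l) b1.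
  move=> fl El; rewrite (perm_gap _ pb1) fl; apply: gap_cons; last by rewrite arlow.
  by case/and3P: G1; rewrite has_filter.
case/and3P: (G1) => _ + _; rewrite has_filter.
case: (seq.filter _ b1) arb1 gx => // z l arb1 gx _.
move=> pf; have := perm_size pf; rewrite size_cat /=.
case: b2 b2n0 s12 a2 b2b' pc pf => // z2 b2 _ s12 a2 b2b' pc pf /= sz.
(* Only [x] and [y] reach [A y]: the gap gives one of them to [b1], and [b2], nonempty and entirely
   above the gap, takes the other. *)
have [l0 b20] : l = [::] /\ b2 = [::].
  by case: (l) (b2) sz => [|? [|? ?]] [|? ?]; rewrite //= ?addnS.
subst l b2; move: arb1 b2b'; rewrite !block_area_seq1 => arb1 b2b'.
have [[zx zy]|[zx zy]] : (z = x /\ z2 = y) \/ (z = y /\ z2 = x).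
- have := perm_mem pf z; rewrite /= !inE eqxx /= => /esym /orP[] /eqP zE.
    left; split=> //; subst z; move: pf; rewrite /= perm_cons => /perm_mem /(_ z2).
    by rewrite !inE eqxx => /esym/eqP.
  right; split=> //; subst z; move: pf; rewrite (@perm_catC _ [:: y] [:: z2]) /=.
  have -> : [:: x; y] = [:: x] ++ [:: y] by [].
  rewrite -[[:: z2; y]]/([:: z2] ++ [:: y]) perm_cat2r => /perm_mem /(_ z2).
  by rewrite !inE eqxx => /esym/eqP.
(* Here [y] stands alone although [x] is no smaller. Since [A x] is then a gap of [b1], the second
   clause of [sibling] leaves only a tie. *)
- subst z z2; suff xy : A x = A y by split; lra.
  have /gx/s12 : 2 * ar E < A x by lra.
  by rewrite /= andbT => xy; apply/eqP; rewrite eq_le yx xy.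
- by subst z z2; split; lra.
Qed.

Lemma perm_sibling b b2 b' : perm_eq b b2 -> sibling b b' -> sibling b2 b'.
Proof.
move=> p [s1 s2 s3]; split.
- by rewrite -(perm_size p) -(perm_block_area p).
- by move=> t; rewrite -(perm_gap _ p); exact: s2.
- by move=> x y E /(perm_trans p); exact: s3.
Qed.

Lemma perm_siblingr b b' b2 : perm_eq b' b2 -> sibling b b' -> sibling b b2.
Proof.
move=> p [s1 s2 s3]; split.
- by rewrite -(perm_block_area p).
- by move=> t /s2; rewrite (perm_all _ p).
- by rewrite -(perm_block_area p).
Qed.

Lemma sibling_catr b b1 b2 : sibling b b1 -> sibling b b2 -> sibling b (b1 ++ b2).
Proof.
have := block_area_ge0 b1; have := block_area_ge0 b2.
move=> g2 g1 [s1 s2 s3] [t1 t2 t3]; split.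
- by move=> /s1; rewrite block_area_cat; lra.
- by move=> t g; rewrite all_cat s2 ?t2.
- move=> x y E pc En0 Ey yx; rewrite block_area_cat.
  by have [] := s3 _ _ _ pc En0 Ey yx; split; lra.
Qed.

Lemma sibling_cat b1 b2 b' :
  sibling b1 b2 -> sibling b2 b1 -> sibling b1 b' -> sibling b2 b' ->
  sibling b' b1 -> sibling b' b2 -> b1 != [::] -> b2 != [::] -> b' != [::] ->
  ar b1 <= ar b' -> ar b2 <= ar b' -> sibling (b1 ++ b2) b'.
Proof.
move=> s12 s21 s1' s2' s'1 s'2 n1 n2 n' le1 le2; split.
- by move=> _; rewrite block_area_cat; lra.
(* The gap falls between the two merged blocks. Then [b'] has area at least [t], more than twice the
   low block, so it is a single area by the first clause, and this area is at least [t]. *)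
- have pure t a b : all (fun i => t <= A i) a -> a != [::] -> ar a <= ar b' ->
      2 * ar b < t -> sibling b' b -> all (fun i => t <= A i) b'.
    move=> ha na aleb' bt [s _ _]; have ta := all_high_area ha na.
    have : (size b' <= 1)%N by rewrite leqNgt; apply/negP => /s; lra.
    by move=> /all_high_single; apply=> //; lra.
  move=> t /(gap_cat s12 s21) [[g _]|[g _]|[_ h _ _ l]|[_ h _ _ l]].
  + by case: s1' => _ /(_ _ g).
  + by case: s2' => _ /(_ _ g).
  + exact: (pure t b2 b1).
  + exact: (pure t b1 b2).
- move=> x y E pc En0 Ey yx.
  have gc : gap (A y) (b1 ++ b2).
    have -> : gap (A y) (b1 ++ b2) = gap (A y) (x :: y :: E) by apply: perm_gap.
    have lx : (A x < A y) = false by rewrite ltNge yx.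
    by have := gap_cons En0 Ey; rewrite /gap /low_sum !big_cons /= lx yx lexx.
  have pc' : perm_eq (b2 ++ b1) (x :: y :: E) by rewrite perm_catC.
  (* If the gap [A y] fell between the merged blocks, the high one would consist of [x] and [y] and
     be more than twice the low one, against the first clause. *)
  have pure a b : all (fun i => A i < A y) a -> all (fun i => A y <= A i) b ->
      perm_eq (a ++ b) (x :: y :: E) -> sibling b a -> b != [::] ->
      2 * ar a < A y -> A x <= ar b' /\ A y + ar E <= ar b'.
    move=> la hb pab [sba _ _] bn0 lay; exfalso.
    have xa : x \notin a by apply/negP => /(allP la); rewrite ltNge yx.
    have ya : y \notin a by apply/negP => /(allP la); rewrite ltxx.
    have : perm_eq b [:: x; y].
      have := perm_filter (fun i => A y <= A i) pab.
      rewrite filter_cat (_ : [seq i <- a | _] = [::]); last first.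
        by apply/eqP; rewrite -[_ == _]negbK -has_filter has_highN negbK.
      rewrite (_ : [seq i <- b | _] = b); last exact/all_filterP.
      rewrite /= yx lexx (_ : [seq i <- E | _] = [::]) //.
      apply/eqP; rewrite -[_ == _]negbK -has_filter has_highN negbK.
      by apply/allP => j jE; have := mem_block_area jE; have := block_area_ge0 E; lra.
    move=> pb; have := all_high_area hb bn0; move: sba.
    by rewrite (perm_size pb) => /(_ isT); lra.
  have [[g h]|[g h]|[l h _ _ lt]|[l h _ _ lt]] := gap_cat s12 s21 gc.
  + exact: (@sibling_cat_gap b1 b2).
  + exact: (@sibling_cat_gap b2 b1).
  + exact: (pure b1 b2).
  + exact: (pure b2 b1).
Qed.

(** Permuting two entries to the front ranges over ordered pairs of positions, so that equal blocks
    at different places count as a pair. *)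
Definition siblings bs : Prop :=
  all (fun b => b != [::]) bs /\
  forall b b' r, perm_eq bs (b :: b' :: r) -> sibling b b'.

Lemma siblings_merge b1 b2 r c : perm_eq c (b1 ++ b2) ->
  (forall b, b \in r -> ar b1 <= ar b /\ ar b2 <= ar b) ->
  siblings (b1 :: b2 :: r) -> siblings (c :: r).
Proof.
move=> pc rmin [/= /and3P[n1 n2 nr] sib]; split=> /=.
  rewrite nr andbT -size_eq0 (perm_size pc) size_cat addn_eq0 negb_and size_eq0.
  by rewrite n1.
have sib2 b b' r' : perm_eq r (b :: b' :: r') -> sibling b b'.
  move=> pr; apply: (sib _ _ (b1 :: b2 :: r')).
  rewrite -[b1 :: b2 :: r]/([:: b1; b2] ++ r).
  rewrite -[b :: b' :: _]/([:: b; b'] ++ [:: b1; b2] ++ r') perm_sym perm_catCA perm_cat2l.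
  by rewrite perm_sym.
have sib1 b r' : perm_eq r (b :: r') ->
   [/\ sibling b b1, sibling b b2, sibling b1 b & sibling b2 b].
  move=> pr; have p3 : perm_eq (b1 :: b2 :: r) [:: b1, b2, b & r'].
    by rewrite !perm_cons.
  have pp l : perm_eq [:: b1, b2, b & r'] l -> perm_eq (b1 :: b2 :: r) l.
    exact: perm_trans.
  split; [apply: (sib _ _ (b2 :: r')) | apply: (sib _ _ (b1 :: r')) |
          apply: (sib _ _ (b2 :: r')) | apply: (sib _ _ (b1 :: r'))]; apply: pp;
    by apply/permP => p /=; clear; lia.
have s12 : sibling b1 b2 by apply: (sib _ _ r).
have s21 : sibling b2 b1 by apply: (sib _ _ r); apply/permP => p /=; rewrite addnCA.
have c1 b r' : perm_eq r (b :: r') -> sibling c b /\ sibling b c.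
  move=> pr; have [sb1 sb2 s1b s2b] := sib1 _ _ pr; split.
    have br : b \in r by rewrite (perm_mem pr) mem_head.
    have [? ?] := rmin _ br.
    apply: (@perm_sibling (b1 ++ b2)); first by rewrite perm_sym.
    by apply: sibling_cat => //; exact: (allP nr).
  apply: (@perm_siblingr _ (b1 ++ b2)); first by rewrite perm_sym.
  exact: sibling_catr.
move=> b b' r' p.
have [bc|bc] := eqVneq b c.
  by subst b; move: p; rewrite perm_cons => /c1[].
have [bc'|bc'] := eqVneq b' c.
  subst b'; have : perm_eq (c :: r) (c :: b :: r').
    by apply: perm_trans p _; apply/permP => q /=; rewrite addnCA.
  by rewrite perm_cons => /c1[].
have cr : c \in r'.
  have := perm_mem p c; rewrite !inE eqxx /= (eq_sym c b) (eq_sym c b').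
  by rewrite (negPf bc) (negPf bc').
apply: (sib2 _ _ (rem c r')).
rewrite -(perm_cons c); apply: perm_trans p _.
have := perm_to_rem cr => pr'.
apply: (@perm_trans _ (b :: b' :: c :: rem c r')); first by rewrite !perm_cons.
by apply/permP => q /=; rewrite [RHS]addnCA; congr (_ + _)%N; rewrite addnCA.
Qed.

Definition split_of s s1 s2 : Prop :=
  [/\ perm_eq s (s1 ++ s2), s1 != [::] /\ s2 != [::],
      sorted_areas A s1 /\ sorted_areas A s2,
      ar s2 <= ar s1 & sibling s1 s2 /\ sibling s2 s1].

Lemma sorted_blocks_last bs b1 b2 b :
  sorted_blocks A (bs ++ [:: b1; b2]) -> b \in bs ->
  ar b1 <= ar b /\ ar b2 <= ar b.
Proof.
have tr : transitive (fun b c => ar c <= ar b).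
  by move=> y x z yx zy; exact: le_trans zy yx.
rewrite /sorted_blocks (sorted_pairwise tr) pairwise_cat => /and3P[+ _ _] bbs.
by rewrite allrelC /= => /andP[/allP/(_ _ bbs) + /andP[/allP/(_ _ bbs)]].
Qed.

Lemma merge_blocks_split bs s1 s2 :
  merge_blocks A bs s1 s2 -> sorted_blocks A bs -> siblings bs ->
  all (sorted_areas A) bs -> split_of (flatten bs) s1 s2.
Proof.
elim=> {bs s1 s2} [b1 b2|bs1 bs2 b1 b2 c s1 s2 _ pc sc sb _ IH] sbs sib.
  rewrite /= andbT => /andP[sb1 sb2]; move: sib => [/= /and3P[n1 n2 _] sib].
  move: sbs; rewrite /sorted_blocks /= andbT => b21; rewrite cats0.
  split=> //; split; first by apply: (sib _ _ [::]).
  by apply: (sib _ _ [::]); apply/permP => p /=; rewrite addnCA.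
rewrite !all_cat => /and3P[a1 a2 _].
have pI : perm_eq (bs1 ++ bs2 ++ [:: b1; b2]) (b1 :: b2 :: bs1 ++ bs2).
  by rewrite catA perm_catC.
have pc' : perm_eq (bs1 ++ c :: bs2) (c :: bs1 ++ bs2).
  by rewrite -cat1s perm_catCA.
have sib' : siblings (bs1 ++ c :: bs2).
  have [n' s'] : siblings (c :: bs1 ++ bs2).
    apply: siblings_merge pc _ _.
      by move=> b; move: sbs; rewrite catA => /sorted_blocks_last; exact.
    case: sib => n s; split; first by rewrite -(perm_all _ pI).
    by move=> b b' r p; apply: s (perm_trans pI p).
  split; first by rewrite (perm_all _ pc').
  by move=> b b' r p; apply: (s' _ _ r); rewrite -(permPl pc').
have [] := IH sb sib'; first by rewrite all_cat /= sc a1 a2.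
move=> p; split=> //; apply: perm_trans p.
rewrite !flatten_cat /= cats0 perm_cat2l perm_catC perm_cat2r perm_sym.
exact: pc.
Qed.

(** The invariant starts vacuously: a singleton has no gap and is too short for the other two
    clauses. *)
Lemma split_of_merge s s1 s2 : sorted_areas A s ->
  merge_blocks A [seq [:: i] | i <- s] s1 s2 -> split_of s s1 s2.
Proof.
move=> ss /merge_blocks_split; rewrite flatten_seq1; apply.
- rewrite /sorted_blocks sorted_map; apply: sub_sorted ss => i j /=.
  by rewrite !block_area_seq1.
- split; first by apply/allP => b /mapP[i _ ->].
  move=> b b' r p.
  have : {subset [:: b; b'] <= [seq [:: i] | i <- s]}.
    move=> x; rewrite !inE (perm_mem p) !inE => /orP[->//|->].
    by rewrite orbT.
  move=> sub; have /mapP[i _ ->] := sub b (mem_head _ _).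
  have /mapP[j _ ->] : b' \in [seq [:: i] | i <- s] by apply: sub; rewrite !inE eqxx orbT.
  split=> //.
  + move=> t; rewrite /gap /= !orbF => /and3P[a].
    by rewrite leNgt a.
  + by move=> x y E /perm_size.
- by apply/allP => b /mapP[i _ ->].
Qed.

End Huffman.

(** * Inequalities between square roots *)

Ltac slra :=
  repeat match goal with
  | H : _ = _ |- _ => clear H
  | H : forall _, _ |- _ => clear H
  end; lra.

Ltac side :=
  repeat match goal with H : is_true (_ + _ <= _ * _) |- _ => clear H end; slra.

Section Analytic.
Variable R : realFieldType.
Implicit Types a b d e g k m n r u x A B D G M S U : R.

Lemma ge_of_sqr r p : 0 <= r -> p ^+ 2 <= r ^+ 2 -> p <= r.
Proof. by move=> r0; have [p0|p0] := lerP 0 p; [rewrite ler_sqr | lra]. Qed.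

(* On squares, concavity bounds a root from below by its chord. *)
Lemma chord r lo hi A : 0 <= lo -> 0 <= hi -> 0 <= r -> A = r ^+ 2 ->
  lo ^+ 2 <= A -> A <= hi ^+ 2 -> A + lo * hi <= (lo + hi) * r.
Proof.
move=> lo0 hi0 r0 -> h1 h2.
have p1 : lo <= r by apply: ge_of_sqr.
have p2 : r <= hi by apply: ge_of_sqr.
have : 0 <= (r - lo) * (hi - r) by apply: mulr_ge0; lra.
by rewrite mulrBl !mulrBr expr2; lra.
Qed.

(** A piece of area [r ^+ 2] is taken to have a side of length 1; in the lemmas below that unit is
    the short side of the parent rectangle. The chord joins [15/26 < 1 / sqrt 3] to its reciprocal
    [26/15 > sqrt 3]. *)
Lemma single_le r : 0 <= r -> 1 / 3 <= r ^+ 2 -> r ^+ 2 <= 3 -> r ^+ 2 + 1 <= 1203/500 * r.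
Proof.
move=> r0 h1 h2; have := @chord r (15/26) (26/15) _ _ _ r0 erefl; lra.
Qed.

(** The last term turns the surplus [k / 4] of the sibling into the surplus [n / 4] that
    [nogap_bound] demands of the parent. *)
Lemma single_child r k n A B : 0 <= r -> 0 <= k -> 0 <= n -> A = r ^+ 2 -> B = k ^+ 2 ->
  n ^+ 2 = A + B -> 1 <= A + B -> A + B <= 3 -> A <= 2 * B -> B <= 2 * A ->
  A + 1 <= 1203/500 * r - (n - k) / 4.
Proof.
move=> r0 k0 n0 Ar Bk nAB h1 h3 AB BA.
have nle : n <= (A + B + 1) / 2.
  by have := sqr_ge0 (n - 1); rewrite sqrrB expr1n mulr1 nAB; lra.
have [h|h] := lerP A 1.
- have := @chord r (15/26) 1 _ _ _ r0 Ar.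
  have [h'|h'] := lerP B 1.
    by have := @chord k (15/26) 1 _ _ _ k0 Bk; lra.
  by have := @chord k 1 (17/12) _ _ _ k0 Bk; lra.
- have := @chord r 1 (17/12) _ _ _ r0 Ar.
  have [h'|h'] := lerP B 1.
    by have := @chord k (15/26) 1 _ _ _ k0 Bk; lra.
  by have := @chord k 1 (17/12) _ _ _ k0 Bk; lra.
Qed.

(** The worst case is [A = 2 * B], with quotient [(1 + sqrt 2) / sqrt 3 > 1.39]; there
    [r * k / n ^+ 2] is [sqrt 2 / 3 > 0.47]. *)
Lemma sqrt_sum r k n A B : 0 <= r -> 0 <= k -> 0 <= n -> A = r ^+ 2 -> B = k ^+ 2 ->
  n ^+ 2 = A + B -> A <= 2 * B -> B <= 2 * A -> 139/100 * n <= r + k.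
Proof.
move=> r0 k0 n0 Ar Bk nAB AB BA.
have rk0 : 0 <= r * k by apply: mulr_ge0.
have h : (47/100 * n ^+ 2) ^+ 2 <= (r * k) ^+ 2.
  have : 0 <= (2 * B - A) * (2 * A - B) by apply: mulr_ge0; lra.
  by rewrite nAB [(r * k) ^+ 2]exprMn -Ar -Bk; nra.
have h2 : 47/100 * n ^+ 2 <= r * k by apply: ge_of_sqr.
apply: ge_of_sqr; first lra.
by rewrite exprMn sqrrD -Ar -Bk -mulr_natl; lra.
Qed.

Lemma pair_le r k n A B : 0 <= r -> 0 <= k -> 0 <= n -> A = r ^+ 2 -> B = k ^+ 2 ->
  n ^+ 2 = A + B -> 1 <= A + B -> A + B <= 3 -> A <= 2 * B -> B <= 2 * A ->
  A + B + 2 <= 1203/500 * (r + k) - n / 4.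
Proof.
move=> r0 k0 n0 Ar Bk nAB h1 h3 AB BA.
have := sqrt_sum r0 k0 n0 Ar Bk nAB AB BA.
have : A + B + 1 * 2 <= (1 + 2) * n by apply: chord; lra.
lra.
Qed.

(* [r], [e], [n] are the square roots of the areas of a dominant piece, of the
   rest, and of their union. *)
Lemma dominant_gain r e n : 0 <= r -> 0 <= e -> 0 <= n ->
  n ^+ 2 = r ^+ 2 + e ^+ 2 -> 2 * e ^+ 2 <= r ^+ 2 ->
  16/10 * e <= 1203/500 * (r + e - n).
Proof.
move=> r0 e0 n0 nre er.
have re : 141/100 * e <= r by apply: ge_of_sqr => //; rewrite exprMn; nra.
have : n <= r + 33/100 * e; last lra.
apply: ge_of_sqr; first lra.
have := mulr_ge0 e0 (_ : 0 <= r - 141/100 * e) => /(_ ltac:(lra)).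
by rewrite nre sqrrD exprMn -mulr_natl; nra.
Qed.
(** The extremal configuration: [A] is undivided, and a strip of width [B + G <= 1] is cut into [B]
    and [G]. The wall of length [G / (B + G)] inside [G] is counted as [1/2]. At [A = B = G = 1/3]
    the two sides differ by less than 1/1000, which forces the fine case distinction. *)
Lemma three_le0 a b g A B G : 0 <= a -> 0 <= b -> 0 <= g ->
  A = a ^+ 2 -> B = b ^+ 2 -> G = g ^+ 2 -> G <= B -> B <= A -> B <= 2 * G ->
  A <= 2 * (B + G) -> 1 <= A + B + G -> B + G <= 1 ->
  A + 2 * (B + G) + 5 / 2 <= 1203/500 * (a + b + g).
Proof.
move=> a0 b0 g0 Aa Bb Gg GB BA BG ABG h1 h2.
have ca lo hi h h' := @chord a lo hi A h h' a0 Aa.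
have cb lo hi h h' := @chord b lo hi B h h' b0 Bb.
have cg lo hi h h' := @chord g lo hi G h h' g0 Gg.
have /orP[hA|hA] := le_total A (2/5).
  (* The fractions [56/97] and [97/168] are consecutive convergents of [1 / sqrt 3], from below and
     from above. *)
  have A1 : A + 56/97 * (31/49) <= (56/97 + 31/49) * a by apply: (ca); side.
  have /orP[hB|hB] := le_total B (1/3).
    have B1 : B + 6/11 * (97/168) <= (6/11 + 97/168) * b by apply: (cb); side.
    have G1 : G + 16/31 * (97/168) <= (16/31 + 97/168) * g by apply: (cg); side.
    by slra.
  have B1 : B + 56/97 * (31/49) <= (56/97 + 31/49) * b by apply: (cb); side.
  have /orP[hG|hG] := le_total G (1/3).
    have G1 : G + 38/85 * (97/168) <= (38/85 + 97/168) * g by apply: (cg); side.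
    by slra.
  have G1 : G + 56/97 * (31/49) <= (56/97 + 31/49) * g by apply: (cg); side.
  by slra.
have /orP[hA'|hA'] := le_total A (2/3); last first.
  have A1 : A + 40/49 * (99/70) <= (40/49 + 99/70) * a by apply: (ca); side.
  have B1 : B + 20/49 * (9/11) <= (20/49 + 9/11) * b by apply: (cb); side.
  have G1 : G + 1/3 * (29/41) <= (1/3 + 29/41) * g by apply: (cg); side.
  by slra.
have A1 : A + 12/19 * (9/11) <= (12/19 + 9/11) * a by apply: (ca); side.
have /orP[hB|hB] := le_total B (2/5); last first.
  have B1 : B + 12/19 * (9/11) <= (12/19 + 9/11) * b by apply: (cb); side.
  have G1 : G + 38/85 * (29/41) <= (38/85 + 29/41) * g by apply: (cg); side.
  by slra.
have B1 : B + 20/49 * (31/49) <= (20/49 + 31/49) * b by apply: (cb); side.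
have /orP[hG|hG] := le_total G (1/5).
  have G1 : G + 1/3 * (9/20) <= (1/3 + 9/20) * g by apply: (cg); side.
  by slra.
have /orP[hG'|hG'] := le_total G (3/10).
  have G1 : G + 38/85 * (17/31) <= (38/85 + 17/31) * g by apply: (cg); side.
  by slra.
have G1 : G + 6/11 * (31/49) <= (6/11 + 31/49) * g by apply: (cg); side.
by slra.
Qed.

(** The block of area [G] is dominated, and [D] is the gain of [dominated_thin_gain]. If [G] exceeds
    [B], the wall is longer than [1/2]; [D] pays for the difference, and [B] and [G] exchange roles
    in [three_le0]. *)
Lemma three_narrow a b g A B G D : 0 < a -> 0 < b -> 0 < g ->
  A = a ^+ 2 -> B = b ^+ 2 -> G = g ^+ 2 -> B <= A -> G <= A ->
  B <= 2 * G -> 2 * G <= 3 * B -> A <= 2 * (B + G) ->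
  1 <= A + B + G -> B + G <= 1 -> 0 <= D -> G - B <= D * g ->
  A + 2 * (B + G) + 2 + G / (B + G) <= 1203/500 * (a + b + g) + D.
Proof.
move=> a0 b0 g0 Aa Bb Gg BA GA BG GB ABG h1 h2 D0 Dg.
have B0 : 0 < B by rewrite Bb exprn_gt0.
have G0 : 0 < G by rewrite Gg exprn_gt0.
have main : A + 2 * (B + G) + 5 / 2 <= 1203/500 * (a + b + g).
  have /orP[GleB|BleG] := le_total G B.
    by apply: (@three_le0 a b g) => //; lra.
  have -> : a + b + g = a + g + b by lra.
  by rewrite [B + G]addrC; apply: (@three_le0 a g b) => //; lra.
have : G / (B + G) <= 1 / 2 + D; last lra.
rewrite ler_pdivrMr; last lra.
have /orP[GleB|BleG] := le_total G B.
  have : 0 <= D * (B + G) by apply: mulr_ge0; lra.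
  lra.
have g3 : 1 / 3 <= g by apply: ge_of_sqr; lra.
have gle : g <= 2 * (B + G).
  have : g * (1 / 3) <= g ^+ 2 by rewrite expr2 ler_pM2l.
  lra.
by have := ler_wpM2l D0 gle; lra.
Qed.

Lemma three_wide a b g A B G D : 0 < a -> 0 < b -> 0 < g ->
  A = a ^+ 2 -> B = b ^+ 2 -> G = g ^+ 2 -> B <= A -> G <= A ->
  B <= 2 * G -> 2 * G <= 3 * B -> A <= 2 * (B + G) ->
  A + B + G <= 3 -> 1 <= B + G -> 0 <= D -> G - B <= D * g ->
  A + B + G + 3 + Num.min G 1 <= 1203/500 * (a + b + g) + D.
Proof.
move=> a0 b0 g0 Aa Bb Gg BA GA BG GB ABG h1 h2 D0 Dg.
have ca lo hi h h' := @chord a lo hi A h h' (ltW a0) Aa.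
have cb lo hi h h' := @chord b lo hi B h h' (ltW b0) Bb.
have cg lo hi h h' := @chord g lo hi G h h' (ltW g0) Gg.
have /orP[hG|hG] := le_total 1 G.
  rewrite min_r //; clear Dg.
  have A1 : A + 1 * (5/4) <= (1 + 5/4) * a by apply: (ca); side.
  have B1 : B + 4/5 * (5/4) <= (4/5 + 5/4) * b by apply: (cb); side.
  have G1 : G + 1 * (5/4) <= (1 + 5/4) * g by apply: (cg); side.
  by slra.
rewrite min_l //.
have g1 : g <= 1 by apply: ge_of_sqr => //; rewrite expr1n -Gg.
have {Dg}DGB : G - B <= D.
  by apply: le_trans Dg _; rewrite ler_piMr.
have /orP[hA|hA] := le_total A (2/3).
  have A1 : A + 7/10 * (9/11) <= (7/10 + 9/11) * a by apply: (ca); side.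
  have B1 : B + 4/7 * (9/11) <= (4/7 + 9/11) * b by apply: (cb); side.
  have G1 : G + 4/7 * (9/11) <= (4/7 + 9/11) * g by apply: (cg); side.
  slra.
have /orP[hA'|hA'] := le_total A 1.
  have A1 : A + 4/5 * 1 <= (4/5 + 1) * a by apply: (ca); side.
  have B1 : B + 3/5 * 1 <= (3/5 + 1) * b by apply: (cb); side.
  have G1 : G + 4/7 * 1 <= (4/7 + 1) * g by apply: (cg); side.
  slra.
have A1 : A + 1 * (3/2) <= (1 + 3/2) * a by apply: (ca); side.
have B1 : B + 3/5 * (6/5) <= (3/5 + 6/5) * b by apply: (cb); side.
have G1 : G + 1/2 * 1 <= (1/2 + 1) * g by apply: (cg); side.
slra.
Qed.

(** Here [u] is the root of the area of a gap-free block next to the two pieces; [nogap_bound]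
    leaves a quarter of it unspent. *)
Lemma two_le b g u B G D : 0 < b -> 0 < g ->
  B = b ^+ 2 -> G = g ^+ 2 -> B <= 2 * G -> 2 * G <= 3 * B ->
  1 <= B + G -> B + G <= 3 -> b <= u -> g <= u -> 0 <= D -> G - B <= D * g ->
  B + G + 2 + Num.min G 1 <= 1203/500 * (b + g) + u / 4 + D.
Proof.
move=> b0 g0 Bb Gg BG GB h1 h2 bu gu D0 Dg.
have cb lo hi h h' := @chord b lo hi B h h' (ltW b0) Bb.
have cg lo hi h h' := @chord g lo hi G h h' (ltW g0) Gg.
have /orP[hG|hG] := le_total 1 G.
  rewrite min_r //.
  have G1 : G + 1 * (7/5) <= (1 + 7/5) * g by apply: (cg); side.
  have /orP[hB|hB] := le_total 1 B.
    have B1 : B + 1 * (3/2) <= (1 + 3/2) * b by apply: (cb); side.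
    clear Dg; slra.
  have B1 : B + 4/5 * 1 <= (4/5 + 1) * b by apply: (cb); side.
  have g2 : g <= 7/5 by clear Dg; apply: ge_of_sqr; rewrite -?Gg; slra.
  have : D * g <= D * (7/5) by rewrite ler_wpM2l.
  slra.
rewrite min_l //.
have g1 : g <= 1 by apply: ge_of_sqr => //; rewrite expr1n -Gg.
have {Dg}DGB : G - B <= D.
  by apply: le_trans Dg _; rewrite ler_piMr.
have /orP[hB|hB] := le_total B (2/3).
  have B1 : B + 4/7 * (9/11) <= (4/7 + 9/11) * b by apply: (cb); side.
  have /orP[hG'|hG'] := le_total G (2/3).
    have G1 : G + 4/7 * (9/11) <= (4/7 + 9/11) * g by apply: (cg); side.
    slra.
  have G1 : G + 4/5 * 1 <= (4/5 + 1) * g by apply: (cg); side.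
  slra.
have G1 : G + 4/7 * 1 <= (4/7 + 1) * g by apply: (cg); side.
have /orP[hB'|hB'] := le_total 1 B.
  have B1 : B + 1 * (3/2) <= (1 + 3/2) * b by apply: (cb); side.
  slra.
have B1 : B + 4/5 * 1 <= (4/5 + 1) * b by apply: (cb); side.
slra.
Qed.

(** A pair of pieces with total area [M] lies next to a dominated block of area [G]. The roots of
    the pair add up to at least [139/100 * m] by [sqrt_sum]. The minima are the cut inside the pair
    and the wall which [thin_bound] concedes to [G]. *)
Lemma pair_dominant m g M G D : 0 < m -> 0 < g ->
  M = m ^+ 2 -> G = g ^+ 2 -> M <= 2 * G -> 4 * G <= 3 * M ->
  1 <= M + G -> M + G <= 3 -> 0 <= D -> G - M / 2 <= D * g ->
  M + G + 2 + Num.min M 1 + Num.min G 1 <= 1203/500 * (139/100 * m + g) + D.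
Proof.
move=> m0 g0 Mm Gg MG GM h1 h2 D0 Dg.
have cb lo hi h h' := @chord m lo hi M h h' (ltW m0) Mm.
have cg lo hi h h' := @chord g lo hi G h h' (ltW g0) Gg.
have gD : g <= 8/7 by clear Dg; apply: ge_of_sqr; rewrite -?Gg; slra.
have {Dg} : G - M / 2 <= 8/7 * D.
  by apply: le_trans Dg _; rewrite mulrC ler_wpM2r.
have /orP[hM|hM] := le_total M 1.
  have M1 : M + 3/4 * 1 <= (3/4 + 1) * m by apply: (cb); side.
  have G1 : G + 4/7 * (7/8) <= (4/7 + 7/8) * g by apply: (cg); side.
  by rewrite !min_l; slra.
have M1 : M + 1 * (10/7) <= (1 + 10/7) * m by apply: (cb); side.
rewrite (min_r hM).
have /orP[hG|hG] := le_total G 1.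
  have G1 : G + 7/10 * 1 <= (7/10 + 1) * g by apply: (cg); side.
  by rewrite min_l; slra.
have G1 : G + 1 * (8/7) <= (1 + 8/7) * g by apply: (cg); side.
by rewrite min_r; slra.
Qed.

Lemma dominant_thin b g B G : 0 < b -> 0 < g ->
  B = b ^+ 2 -> G = g ^+ 2 -> B <= 2 * G -> 2 * G <= 3 * B ->
  1 <= B + G -> B <= 1 -> G <= 1 ->
  B + 2 * G + 2 <= 1203/500 * (b + g) + 2/5.
Proof.
move=> b0 g0 Bb Gg BG GB h1 h2 h3.
have cb lo hi h h' := @chord b lo hi B h h' (ltW b0) Bb.
have cg lo hi h h' := @chord g lo hi G h h' (ltW g0) Gg.
have B1 : B + 3/5 * 1 <= (3/5 + 1) * b by apply: (cb); side.
have G1 : G + 4/7 * 1 <= (4/7 + 1) * g by apply: (cg); side.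
slra.
Qed.

Lemma nogap_slack n : 0 <= n -> 1203/500 * n <= n ^+ 2 + n / 4 + 6/5.
Proof.
(* Completing the square: [539/500] is half of [1203/500 - 1/4], and its square is less than
   [6/5]. *)
move=> n0; have : 0 <= (n - 539/500) ^+ 2 by apply: sqr_ge0.
by rewrite sqrrB -mulr_natl; lra.
Qed.

Lemma dominant_wide r e : 0 < r -> 0 < e -> 2/3 <= r ^+ 2 -> r ^+ 2 <= 1 ->
  e ^+ 2 <= 1 -> 1 <= r ^+ 2 + e ^+ 2 ->
  r ^+ 2 + 1 + (1 - 2/5 * e) <= 1203/500 * r + 3/5.
Proof.
move=> r0 e0 h1 h2 h3 h4.
have e1 : e ^+ 2 <= e by rewrite expr2 ler_piMr //; [lra | apply: ge_of_sqr => //; rewrite expr1n].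
have := @chord r (8/10) 1 _ _ _ (ltW r0) erefl; lra.
Qed.

Lemma single_dominant_wide a g A G : 0 < a -> 0 < g -> A = a ^+ 2 -> G = g ^+ 2 ->
  A <= 2 * G -> 2 * G <= 3 * A -> 1 <= A + G -> A <= 2 -> G <= 1 ->
  A + 1 + (1 - 2/5 * g) <= 1203/500 * a + 3/5.
Proof.
move=> a0 g0 Aa Gg AG GA h1 h2 h3.
have cb lo hi h h' := @chord a lo hi A h h' (ltW a0) Aa.
have cg lo hi h h' := @chord g lo hi G h h' (ltW g0) Gg.
have G1 : G + 4/7 * 1 <= (4/7 + 1) * g by apply: (cg); side.
have /orP[hA|hA] := le_total A (2/3).
  have A1 : A + 5/8 * (9/11) <= (5/8 + 9/11) * a by apply: (cb); side.
  slra.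
have A1 : A + 4/5 * (3/2) <= (4/5 + 3/2) * a by apply: (cb); side.
slra.
Qed.

(** On [[0, 1]] the function [1203/500 * r - r ^+ 2] increases, so the inequality propagates from
    the left end [x] to all larger roots. *)
Lemma wide_le r A x d : 0 < r -> A = r ^+ 2 -> 0 <= x -> x <= 1 -> x ^+ 2 <= A -> A <= 1 ->
  d <= 2/5 -> x ^+ 2 + 1 + d <= 1203/500 * x -> A + 1 + d <= 1203/500 * r.
Proof.
move=> r0 Ar x0 x1 xA A1 d1 h.
have cc : A + x * 1 <= (x + 1) * r by apply: chord => //; [apply: ltW | rewrite expr1n].
have r1 : r <= 1 by apply: ge_of_sqr => //; rewrite expr1n -Ar.
have xr : x <= r by apply: ge_of_sqr; [exact: ltW | rewrite -Ar].
have : 0 <= (r - x) * (1203/500 - r - x).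
  by apply: mulr_ge0; lra.
rewrite Ar; nra.
Qed.

Lemma wide_threetenths r : 0 < r -> 2/3 <= r ^+ 2 -> r ^+ 2 <= 1 ->
  r ^+ 2 + 1 + 3/10 * r ^+ 2 <= 1203/500 * r.
Proof.
by move=> r0 h1 h2; have := @chord r (8/10) 1 _ _ _ (ltW r0) erefl; lra.
Qed.

(** The area [S] is the dominating part of a block of area [G]. The rest of [G] is charged to its
    own lower bound, so only the roots of [U] and [S] appear on the right. *)
Lemma sep_le a k U G S : 0 < a -> 0 < k -> U = a ^+ 2 -> S = k ^+ 2 ->
  S <= G -> 2 * G <= 3 * S -> S <= U -> U <= 2 * G -> 1 <= U + G -> G <= 1 -> U <= 1 ->
  U + G + 2 <= 1203/500 * (a + k).
Proof.
move=> a0 k0 Uu Sk SG GS SU UG h1 h2 h3.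
have cb lo hi h h' := @chord a lo hi U h h' (ltW a0) Uu.
have cg lo hi h h' := @chord k lo hi S h h' (ltW k0) Sk.
have /orP[hS|hS] := le_total S (2/5).
  have S1 : S + 9/20 * (7/11) <= (9/20 + 7/11) * k by apply: (cg); side.
  have /orP[hU|hU] := le_total U (1/2).
    have U1 : U + 3/5 * (5/7) <= (3/5 + 5/7) * a by apply: (cb); side.
    slra.
  have U1 : U + 7/10 * 1 <= (7/10 + 1) * a by apply: (cb); side.
  slra.
have S1 : S + 5/8 * 1 <= (5/8 + 1) * k by apply: (cg); side.
have U1 : U + 5/8 * 1 <= (5/8 + 1) * a by apply: (cb); side.
slra.
Qed.

Lemma sep_wide_le k G S : 0 < k -> S = k ^+ 2 -> S <= G -> 2 * G <= 3 * S ->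
  1 / 2 <= G -> G <= 1 -> G + 1 <= 1203/500 * k + 2/5.
Proof.
move=> k0 Sk SG GS h1 h2.
have cg lo hi h h' := @chord k lo hi S h h' (ltW k0) Sk.
have S1 : S + 4/7 * 1 <= (4/7 + 1) * k by apply: (cg); side.
slra.
Qed.

Lemma sqr_le_mul e x d : 0 <= e -> x = e ^+ 2 -> 0 <= d -> x <= d ^+ 2 -> x <= d * e.
Proof.
move=> e0 -> d0 h; rewrite expr2 ler_wpM2r //; exact: ge_of_sqr.
Qed.

(** The left side is the cost of the layout with the part of area [x] estimated by [thin_bound],
    whose term in [e] is moved to the right. The last term is the bound of [titu] for two pieces
    stacked across a side of length 1. *)
Lemma stack_le a k e U S x G : 0 < a -> 0 < k -> 0 < e -> U = a ^+ 2 -> S = k ^+ 2 ->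
  x = e ^+ 2 -> G = S + x -> 2 * x <= S -> S <= U -> U <= 2 * G -> 1 <= U + G -> G <= 1 ->
  U + 2 + 2 * G + x / G <= 1203/500 * e + 1203/1000 * (1 + U + S + 2 * (a * k)).
Proof.
move=> a0 k0 e0 Ua Sk xe GE xS SU UG UG1 G1.
have ke : k <= a by apply: ge_of_sqr; [exact: ltW | rewrite -Ua -Sk].
have x0 : 0 < x by rewrite xe exprn_gt0.
have akS : S <= a * k by rewrite Sk expr2 ler_pM2r.
have G3 : 1 / 3 <= G by clear - UG UG1; lra.
have /orP[hG|hG] := le_total (1/2) G.
  have /orP[hx|hx] := le_total x (1/5).
    have h1 : x / G <= 2 * x.
      rewrite ler_pdivrMr; last by clear -hG; lra.
      have : x * 1 <= x * (2 * G) by rewrite ler_pM2l //; clear -hG; lra.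
      clear; lra.
    have h2 : x <= 9/20 * e by apply: (sqr_le_mul (ltW e0) xe); clear -hx; lra.
    clear Ua Sk xe ke; lra.
  have h1 : x / G <= 5/3 * x.
    rewrite ler_pdivrMr; last by clear -hG; lra.
    have : x * 1 <= x * (5/3 * G) by rewrite ler_pM2l //; clear -hx xS GE; lra.
    clear; lra.
  have h2 : x <= 29/50 * e.
    by apply: (sqr_le_mul (ltW e0) xe); clear -xS GE G1; lra.
  clear Ua Sk xe ke; lra.
have h1 : x / G <= 3 * x.
  rewrite ler_pdivrMr; last by clear -G3; lra.
  have : x * 1 <= x * (3 * G) by rewrite ler_pM2l //; clear -G3; lra.
  clear; lra.
have h2 : x <= 41/100 * e.
  by apply: (sqr_le_mul (ltW e0) xe); clear -xS GE hG; lra.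
have a7 : 7/10 <= a.
  by apply: ge_of_sqr; [exact: ltW | rewrite -Ua; clear -UG1 hG; lra].
have hk : S + 47/100 * (71/100) <= (47/100 + 71/100) * k.
  apply: (chord _ _ (ltW k0) Sk); clear -xS GE hG G3 x0; lra.
have h3 : 7/10 * k <= a * k by rewrite ler_pM2r.
clear Ua Sk xe ke akS; lra.
Qed.

End Analytic.

(* Divides the goal's homogeneous inequality by [q ^+ 2]. *)
Ltac descale q0 :=
  rewrite -subr_ge0 -(pmulr_rge0 _ q0) -(pmulr_rge0 _ q0); slra.

(** * The same inequalities for a short side of arbitrary length *)

Section Scaled.
Variable R : rcfType.
Implicit Types a b d q t u v x y z D S : R.
Local Notation sqrt := Num.sqrt.

Lemma root_scale q a : 0 < q -> 0 < a ->
  exists r, [/\ 0 < r, a = q * (q * r ^+ 2), sqrt a = q * r & a / q = q * r ^+ 2].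
Proof.
move=> q0 a0; exists (sqrt a / q).
have qn0 : q != 0 by rewrite gt_eqF.
have e : q * (sqrt a / q) ^+ 2 = a / q.
  by rewrite expr_div_n sqr_sqrtr ?ltW // expr2 invfM; field.
split; rewrite ?e //.
- by rewrite divr_gt0 // sqrtr_gt0.
- by rewrite mulrCA divff ?mulr1.
- by rewrite mulrCA divff ?mulr1.
Qed.

Lemma min_scale q a : 0 < q -> Num.min (q * a) q = q * Num.min a 1.
Proof. by move=> q0; rewrite minr_pMr ?ltW // mulr1. Qed.

Lemma sqrt_add_le a b : 0 <= a -> 0 <= b -> sqrt (a + b) <= sqrt a + sqrt b.
Proof.
move=> a0 b0; apply: ge_of_sqr; first by rewrite addr_ge0 ?sqrtr_ge0.
rewrite sqrrD !sqr_sqrtr ?addr_ge0 // lerD2r lerDl.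
by rewrite mulrn_wge0 // mulr_ge0 ?sqrtr_ge0.
Qed.

Lemma sqrt_perim q a : 0 < q -> 0 < a -> 2 * sqrt a <= a / q + q.
Proof.
move=> q0 a0; have [r [r0 _ -> ->]] := root_scale q0 a0.
have -> : q * r ^+ 2 + q = q * (r ^+ 2 + 1) by ring.
rewrite mulrCA ler_pM2l //; have := sqr_ge0 (r - 1); rewrite sqrrB1; lra.
Qed.

Lemma sqrt_add_ge a b : 0 < a -> 0 < b -> a <= 2 * b -> b <= 2 * a ->
  139/100 * sqrt (a + b) <= sqrt a + sqrt b.
Proof.
move=> a0 b0 ab ba; apply: (@sqrt_sum _ _ _ _ a b); rewrite ?sqrtr_ge0 ?sqr_sqrtr //; lra.
Qed.

Lemma scaled_single_le q a : 0 < q -> 0 < a -> q * q <= 3 * a -> a <= 3 * (q * q) ->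
  a / q + q <= 1203/500 * sqrt a.
Proof.
move=> q0 a0; have [r [r0 -> -> ->]] := root_scale q0 a0 => h1 h2.
have -> : q * r ^+ 2 + q = q * (r ^+ 2 + 1) by ring.
by rewrite mulrCA ler_pM2l //; apply: single_le; [exact: ltW|descale q0|descale q0].
Qed.

Lemma scaled_sum q a b : 0 < q -> 0 < a -> 0 < b ->
  exists r k n, [/\ [/\ 0 < r, 0 < k & 0 < n], a = q * (q * r ^+ 2), b = q * (q * k ^+ 2),
    [/\ sqrt a = q * r, sqrt b = q * k & sqrt (a + b) = q * n] &
    [/\ a / q = q * r ^+ 2, b / q = q * k ^+ 2 & n ^+ 2 = r ^+ 2 + k ^+ 2]].
Proof.
move=> q0 a0 b0; have [r [r0 ea sa da]] := root_scale q0 a0.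
have [k [k0 eb sb db]] := root_scale q0 b0.
have [n [n0 en sn dn]] := root_scale q0 (addr_gt0 a0 b0).
exists r, k, n; split=> //; split=> //.
apply: (mulfI (lt0r_neq0 q0)); apply: (mulfI (lt0r_neq0 q0)).
by rewrite -en ea eb; ring.
Qed.

Lemma scaled_single_child q a b : 0 < q -> 0 < a -> 0 < b ->
  q * q <= a + b -> a + b <= 3 * (q * q) -> a <= 2 * b -> b <= 2 * a ->
  a / q + q <= 1203/500 * sqrt a - (sqrt (a + b) - sqrt b) / 4.
Proof.
move=> q0 a0 b0.
have [r [k [n [[r0 k0 n0] ea eb [-> -> ->] [-> _ en]]]]] := scaled_sum q0 a0 b0.
rewrite ea eb => h1 h2 h3 h4.
have H : r ^+ 2 + 1 <= 1203/500 * r - (n - k) / 4.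
  by apply: (@single_child _ r k n _ (k ^+ 2));
    rewrite ?(ltW r0) ?(ltW k0) ?(ltW n0) //; descale q0.
by rewrite -(ler_pM2l q0) in H; lra.
Qed.

Lemma scaled_pair q a b : 0 < q -> 0 < a -> 0 < b ->
  q * q <= a + b -> a + b <= 3 * (q * q) -> a <= 2 * b -> b <= 2 * a ->
  a / q + q + (b / q + q) <= 1203/500 * (sqrt a + sqrt b) - sqrt (a + b) / 4.
Proof.
move=> q0 a0 b0.
have [r [k [n [[r0 k0 n0] ea eb [-> -> ->] [-> -> en]]]]] := scaled_sum q0 a0 b0.
rewrite ea eb => h1 h2 h3 h4.
have H : r ^+ 2 + k ^+ 2 + 2 <= 1203/500 * (r + k) - n / 4.
  by apply: (@pair_le _ r k n); rewrite ?(ltW r0) ?(ltW k0) ?(ltW n0) //; descale q0.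
by rewrite -(ler_pM2l q0) in H; lra.
Qed.

Lemma scaled_nogap_slack q a : 0 < q -> 0 < a ->
  1203/500 * sqrt a <= a / q + sqrt a / 4 + 6/5 * q.
Proof.
move=> q0 a0; have [r [r0 -> -> ->]] := root_scale q0 a0.
have H := nogap_slack (ltW r0).
by rewrite -(ler_pM2l q0) in H; lra.
Qed.

Lemma sqrt_split_gain q a b : 0 < q -> 0 < a -> 0 < b -> a <= 2 * b -> b <= 2 * a ->
  3 * (q * q) <= a + b -> 6/5 * q <= 1203/500 * (sqrt a + sqrt b - sqrt (a + b)).
Proof.
move=> q0 a0 b0 ab ba h; have := sqrt_add_ge a0 b0 ab ba.
have : 173/100 * q <= sqrt (a + b).
  by apply: ge_of_sqr; rewrite ?sqrtr_ge0 // sqr_sqrtr; nra.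
lra.
Qed.

Lemma scaled_dominant_gain a b : 0 < a -> 0 < b -> 2 * b <= a ->
  16/10 * sqrt b <= 1203/500 * (sqrt a + sqrt b - sqrt (a + b)).
Proof.
move=> a0 b0 ba; apply: dominant_gain; rewrite ?sqrtr_ge0 ?sqr_sqrtr //; lra.
Qed.

Lemma div_le_sqrt q a : 0 < q -> 0 < a -> a <= q * q -> a / q <= sqrt a.
Proof.
move=> q0 a0; have [r [r0 -> -> ->]] := root_scale q0 a0 => h.
rewrite ler_pM2l // expr2 ler_piMr //; first exact: ltW.
by apply: ge_of_sqr => //; rewrite expr1n; descale q0.
Qed.

Lemma le_sqrt_scale q a : 0 < q -> q * q <= a -> q <= sqrt a.
Proof.
move=> q0 h; have a0 : 0 <= a by apply: le_trans h; rewrite mulr_ge0 ?ltW.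
by apply: ge_of_sqr; rewrite ?sqrtr_ge0 // sqr_sqrtr // expr2.
Qed.

(** The gain [16/10 * sqrt b] is spent in two parts: the wall [b / q] is at most [sqrt b], and
    [b / sqrt (a + b)] at most [3/5 * sqrt b], because [sqrt b / sqrt (a + b) <= 1 / sqrt 3]. *)
Lemma scaled_dominant_long q a b : 0 < q -> 0 < a -> 0 < b -> 2 * b <= a ->
  a + b <= 3 * (q * q) ->
  b / sqrt (a + b) + b / q <= 1203/500 * (sqrt a + sqrt b - sqrt (a + b)).
Proof.
move=> q0 a0 b0 ba h; have := scaled_dominant_gain a0 b0 ba.
have bq : b / q <= sqrt b by apply: div_le_sqrt => //; lra.
have n0 : 0 < sqrt (a + b) by rewrite sqrtr_gt0 addr_gt0.
have : b / sqrt (a + b) <= 3/5 * sqrt b.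
  have -> : b / sqrt (a + b) = sqrt b / sqrt (a + b) * sqrt b.
    by rewrite mulrAC -expr2 sqr_sqrtr // ltW.
  rewrite ler_pM2r ?sqrtr_gt0 // ler_pdivrMr //.
  have s0 := sqrtr_ge0 (a + b); apply: ge_of_sqr; first by lra.
  by rewrite exprMn !sqr_sqrtr ?ltW ?addr_gt0 //; lra.
lra.
Qed.

Lemma scaled_three q a b v D S : 0 < q -> 0 < a -> 0 < b -> 0 < v ->
  b <= a -> v <= a -> b <= 2 * v -> 2 * v <= 3 * b -> a <= 2 * (b + v) ->
  q * q <= a + b + v -> a + b + v <= 3 * (q * q) -> 0 <= D -> v - b <= D * sqrt v ->
  S = Num.min ((b + v) / q) q ->
  a / q + q + (b / S + S) + (Num.max (v / S) S + 2 * Num.min (v / S) S) <=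
    1203/500 * (sqrt a + sqrt b + sqrt v) + D.
Proof.
move=> q0 a0 b0 v0.
have [x [x0 -> -> ->]] := root_scale q0 a0.
have [r [k [n [[r0 k0 n0] eb ev [sb sv _] [db dv en]]]]] := scaled_sum q0 b0 v0.
rewrite sb sv => h1 h2 h3 h4 h5 h6 h7 D0 hD SE0.
have D'0 : 0 <= D / q by rewrite divr_ge0 // ltW.
have hD' : k ^+ 2 - r ^+ 2 <= D / q * k.
  rewrite -subr_ge0 -(pmulr_rge0 _ q0) -(pmulr_rge0 _ q0).
  have e : q * (D / q * k) = D * k by field; rewrite gt_eqF.
  by rewrite mulrBr e; move: hD; rewrite eb ev; lra.
have mM y z : Num.max y z + 2 * Num.min y z = y + z + Num.min y z :> R.
  by rewrite -(addr_max_min y z); lra.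
rewrite mM; have DE : D = q * (D / q) by field; rewrite gt_eqF.
rewrite eb ev in h1 h2 h3 h4 h5 h6 h7.
have /orP[hS|hS] := le_total (b + v) (q * q).
  have SE : S = q * (r ^+ 2 + k ^+ 2).
    rewrite SE0 min_l; last by rewrite ler_pdivrMr.
    by rewrite mulrDl db dv mulrDr.
  have s0 : 0 < r ^+ 2 + k ^+ 2 by rewrite addr_gt0 ?exprn_gt0.
  have bS : b / S = q * (1 - k ^+ 2 / (r ^+ 2 + k ^+ 2)).
    by rewrite SE eb; field; rewrite !gt_eqF.
  have vS : v / S = q * (k ^+ 2 / (r ^+ 2 + k ^+ 2)).
    by rewrite SE ev; field; rewrite !gt_eqF.
  have : Num.min (v / S) S <= v / S by rewrite ge_min lexx.
  rewrite eb ev in hS.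
  have H : x ^+ 2 + 2 * (r ^+ 2 + k ^+ 2) + 2 + k ^+ 2 / (r ^+ 2 + k ^+ 2) <=
      1203/500 * (x + r + k) + D / q.
    by apply: three_narrow => //; descale q0.
  rewrite -(ler_pM2l q0) [leRHS]mulrDr -DE in H.
  by rewrite bS vS SE; lra.
have SE : S = q by rewrite SE0 min_r // ler_pdivlMr.
rewrite SE db dv min_scale //; rewrite eb ev in hS.
have H : x ^+ 2 + r ^+ 2 + k ^+ 2 + 3 + Num.min (k ^+ 2) 1 <=
      1203/500 * (x + r + k) + D / q.
  by apply: three_wide => //; descale q0.
by rewrite -(ler_pM2l q0) [leRHS]mulrDr -DE in H; lra.
Qed.

Lemma scaled_two q b v u D : 0 < q -> 0 < b -> 0 < v -> b <= 2 * v -> 2 * v <= 3 * b ->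
  q * q <= b + v -> b + v <= 3 * (q * q) -> b <= u -> v <= u -> 0 <= D ->
  v - b <= D * sqrt v ->
  b / q + q + (Num.max (v / q) q + 2 * Num.min (v / q) q) <=
    1203/500 * (sqrt b + sqrt v) + sqrt u / 4 + D.
Proof.
move=> q0 b0 v0 h3 h4 h6 h7 bu vu D0.
have u0 : 0 < u by apply: lt_le_trans bu.
have [x [x0 eu su du]] := root_scale q0 u0.
have [r [k [n [[r0 k0 n0] eb ev [sb sv _] [db dv en]]]]] := scaled_sum q0 b0 v0.
rewrite sb sv su db dv => hD.
have D'0 : 0 <= D / q by rewrite divr_ge0 // ltW.
have hD' : k ^+ 2 - r ^+ 2 <= D / q * k.
  rewrite -subr_ge0 -(pmulr_rge0 _ q0) -(pmulr_rge0 _ q0).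
  have e : q * (D / q * k) = D * k by field; rewrite gt_eqF.
  by rewrite mulrBr e; move: hD; rewrite eb ev; lra.
have DE : D = q * (D / q) by field; rewrite gt_eqF.
rewrite eb ev eu in h3 h4 h6 h7 bu vu.
have rx : r <= x by apply: ge_of_sqr; [exact: ltW | descale q0].
have kx : k <= x by apply: ge_of_sqr; [exact: ltW | descale q0].
have H : r ^+ 2 + k ^+ 2 + 2 + Num.min (k ^+ 2) 1 <= 1203/500 * (r + k) + x / 4 + D / q.
  by apply: two_le => //; descale q0.
rewrite -(ler_pM2l q0) [leRHS]mulrDr -DE in H.
have := addr_max_min (q * k ^+ 2) q; rewrite min_scale //; lra.
Qed.

Lemma scaled_pair_dominant q a b v D S : 0 < q -> 0 < a -> 0 < b -> 0 < v ->
  a <= 2 * b -> b <= 2 * a -> a + b <= 2 * v -> 4 * v <= 3 * (a + b) ->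
  q * q <= a + b + v -> a + b + v <= 3 * (q * q) -> 0 <= D ->
  v - (a + b) / 2 <= D * sqrt v ->
  S = Num.min ((a + b) / q) q ->
  a / S + S + (b / S + S) + (Num.max (v / q) q + 2 * Num.min (v / q) q) <=
    1203/500 * (sqrt a + sqrt b + sqrt v) + D.
Proof.
move=> q0 a0 b0 v0 ab ba h3 h4 h6 h7 D0.
have := sqrt_add_ge a0 b0 ab ba.
have [r [k [n [[r0 k0 n0] eb ev [-> -> _] [db dv en]]]]] := scaled_sum q0 (addr_gt0 a0 b0) v0.
rewrite dv => hn hD SE0.
have D'0 : 0 <= D / q by rewrite divr_ge0 // ltW.
have hD' : k ^+ 2 - r ^+ 2 / 2 <= D / q * k.
  rewrite -subr_ge0 -(pmulr_rge0 _ q0) -(pmulr_rge0 _ q0).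
  have e : q * (D / q * k) = D * k by field; rewrite gt_eqF.
  by rewrite mulrBr e; move: hD; rewrite eb ev; lra.
have DE : D = q * (D / q) by field; rewrite gt_eqF.
have SE : a / S + b / S = q * Num.max (r ^+ 2) 1.
  rewrite -mulrDl SE0 db min_scale // eb.
  have m0 : 0 < Num.min (r ^+ 2) 1 by rewrite lt_min exprn_gt0 // ltr01.
  have : Num.max (r ^+ 2) 1 * Num.min (r ^+ 2) 1 = r ^+ 2.
    have /orP[h|h] := le_total (r ^+ 2) 1.
      by rewrite max_r ?min_l // mul1r.
    by rewrite max_l ?min_r // mulr1.
  by move=> {1}<-; field; rewrite !gt_eqF.
have SE' : S = q * Num.min (r ^+ 2) 1 by rewrite SE0 db min_scale.
rewrite eb ev in h3 h4 h6 h7.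
have H : r ^+ 2 + k ^+ 2 + 2 + Num.min (r ^+ 2) 1 + Num.min (k ^+ 2) 1 <=
    1203/500 * (139/100 * r + k) + D / q.
  by apply: pair_dominant => //; descale q0.
rewrite -(ler_pM2l q0) [leRHS]mulrDr -DE in H.
have := addr_max_min (q * k ^+ 2) q; rewrite min_scale //.
have := congr1 (fun z => q * z) (addr_max_min (r ^+ 2) 1); rewrite /= !mulrDr; lra.
Qed.

Lemma scaled_wide_le q a x d : 0 < q -> 0 < a -> 0 <= x -> x <= 1 ->
  x ^+ 2 * (q * q) <= a -> a <= q * q -> d <= 2/5 ->
  x ^+ 2 + 1 + d <= 1203/500 * x -> a / q + q + d * q <= 1203/500 * sqrt a.
Proof.
move=> q0 a0; have [r [r0 -> -> ->]] := root_scale q0 a0 => h1 h2 h3 h4 h5 h6.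
have H : r ^+ 2 + 1 + d <= 1203/500 * r.
  by apply: (@wide_le _ r _ x) => //; descale q0.
by rewrite -(ler_pM2l q0) in H; lra.
Qed.

Lemma scaled_thin q b v : 0 < q -> 0 < b -> 0 < v -> b <= 2 * v -> 2 * v <= 3 * b ->
  q * q <= b + v -> b <= q * q -> v <= q * q ->
  b / q + q + (q + 2 * (v / q)) <= 1203/500 * (sqrt b + sqrt v) + 2/5 * q.
Proof.
move=> q0 b0 v0.
have [r [k [n [[r0 k0 n0] eb ev [-> -> _] [-> -> en]]]]] := scaled_sum q0 b0 v0.
rewrite eb ev => h1 h2 h3 h4 h5.
have H : r ^+ 2 + 2 * k ^+ 2 + 2 <= 1203/500 * (r + k) + 2/5.
  by apply: dominant_thin => //; descale q0.
by rewrite -(ler_pM2l q0) in H; lra.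
Qed.

Lemma scaled_thin_dominant q v : 0 < q -> 0 < v -> q * q <= 4 * v -> v <= q * q ->
  q + 2 * (v / q) <= 1203/500 * sqrt v + 3/5 * q.
Proof.
move=> q0 v0; have [r [r0 -> -> ->]] := root_scale q0 v0 => h1 h2.
have H : 1 + 2 * r ^+ 2 <= 1203/500 * r + 3/5.
  have := @chord _ r (1/2) 1 _ _ _ (ltW r0) erefl.
  have h3 : (1/2) ^+ 2 <= r ^+ 2 by descale q0.
  have h4 : r ^+ 2 <= 1 ^+ 2 by descale q0.
  by move=> /(_ ltac:(lra) ltac:(lra) h3 h4); lra.
by rewrite -(ler_pM2l q0) in H; lra.
Qed.

Lemma scaled_dominant_wide q a b : 0 < q -> 0 < a -> 0 < b -> 2 * (q * q) <= 3 * a ->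
  a <= q * q -> b <= q * q -> q * q <= a + b ->
  a / q + q + (q - 2/5 * sqrt b) <= 1203/500 * sqrt a + 3/5 * q.
Proof.
move=> q0 b0 v0.
have [r [k [n [[r0 k0 n0] eb ev [-> -> _] [-> _ en]]]]] := scaled_sum q0 b0 v0.
rewrite eb ev => h1 h2 h3 h4.
have H : r ^+ 2 + 1 + (1 - 2/5 * k) <= 1203/500 * r + 3/5.
  by apply: dominant_wide => //; descale q0.
by rewrite -(ler_pM2l q0) in H; lra.
Qed.

Lemma scaled_single_dominant_wide q a v : 0 < q -> 0 < a -> 0 < v -> a <= 2 * v ->
  2 * v <= 3 * a -> q * q <= a + v -> a <= 2 * (q * q) -> v <= q * q ->
  a / q + q + (q - 2/5 * sqrt v) <= 1203/500 * sqrt a + 3/5 * q.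
Proof.
move=> q0 b0 v0.
have [r [k [n [[r0 k0 n0] eb ev [-> -> _] [-> _ en]]]]] := scaled_sum q0 b0 v0.
rewrite eb ev => h1 h2 h3 h4 h5.
have H : r ^+ 2 + 1 + (1 - 2/5 * k) <= 1203/500 * r + 3/5.
  by apply: (single_dominant_wide r0 k0 erefl erefl); descale q0.
by rewrite -(ler_pM2l q0) in H; lra.
Qed.

Lemma scaled_threetenths q a : 0 < q -> 0 < a -> 2 * (q * q) <= 3 * a -> a <= q * q ->
  a / q + q + 3/10 * (a / q) <= 1203/500 * sqrt a.
Proof.
move=> q0 a0; have [r [r0 -> -> ->]] := root_scale q0 a0 => h1 h2.
have H : r ^+ 2 + 1 + 3/10 * r ^+ 2 <= 1203/500 * r.
  by apply: wide_threetenths => //; descale q0.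
by rewrite -(ler_pM2l q0) in H; lra.
Qed.

Lemma scaled_sep q u s v : 0 < q -> 0 < u -> 0 < s -> 0 < v -> s <= v -> 2 * v <= 3 * s ->
  s <= u -> u <= 2 * v -> q * q <= u + v -> v <= q * q -> u <= q * q ->
  u / q + q + (v / q + q) <= 1203/500 * (sqrt u + sqrt s).
Proof.
move=> q0 u0 s0 v0; have [g [g0 ev _ ->]] := root_scale q0 v0.
have [r [k [n [[r0 k0 n0] eu es [-> -> _] [-> _ en]]]]] := scaled_sum q0 u0 s0.
rewrite eu es ev => h1 h2 h3 h4 h5 h6 h7.
have H : r ^+ 2 + g ^+ 2 + 2 <= 1203/500 * (r + k).
  by apply: (sep_le r0 k0 erefl erefl); descale q0.
by rewrite -(ler_pM2l q0) in H; lra.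
Qed.

Lemma scaled_sep_wide q s v : 0 < q -> 0 < s -> 0 < v -> s <= v -> 2 * v <= 3 * s ->
  q * q <= 2 * v -> v <= q * q ->
  v / q + q <= 1203/500 * sqrt s + 2/5 * q.
Proof.
move=> q0 s0 v0; have [g [g0 ev _ ->]] := root_scale q0 v0.
have [k [k0 es -> _]] := root_scale q0 s0.
rewrite es ev => h1 h2 h3 h4.
have H : g ^+ 2 + 1 <= 1203/500 * k + 2/5.
  by apply: (sep_wide_le k0 erefl); descale q0.
by rewrite -(ler_pM2l q0) in H; lra.
Qed.

Lemma scaled_stack q a b x : 0 < q -> 0 < a -> 0 < b -> 0 < x ->
  2 * x <= b -> b <= a -> a <= 2 * (b + x) -> q * q <= a + (b + x) -> b + x <= q * q ->
  a / q + 2 * q + 2 * ((b + x) / q) + q * (x / (b + x)) <=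
    1203/500 * sqrt x + 1203/1000 * ((sqrt a + sqrt b) ^+ 2 / q + q).
Proof.
move=> q0 a0 b0 x0.
have [r [k [n [[r0 k0 n0] ea eb [-> -> _] [da db en]]]]] := scaled_sum q0 a0 b0.
have [e [e0 ex -> dx]] := root_scale q0 x0.
have dv : (b + x) / q = q * k ^+ 2 + q * e ^+ 2 by rewrite mulrDl db dx.
rewrite da dv => h1 h2 h3 h4 h5; rewrite ea eb ex in h1 h2 h3 h4 h5.
have H : r ^+ 2 + 2 + 2 * (k ^+ 2 + e ^+ 2) + e ^+ 2 / (k ^+ 2 + e ^+ 2) <=
    1203/500 * e + 1203/1000 * (1 + r ^+ 2 + k ^+ 2 + 2 * (r * k)).
  by apply: stack_le => //; descale q0.
have -> : x / (b + x) = e ^+ 2 / (k ^+ 2 + e ^+ 2).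
  rewrite eb ex; have : 0 < k ^+ 2 + e ^+ 2 by rewrite addr_gt0 ?exprn_gt0.
  by move=> ke0; field; rewrite gt_eqF // gt_eqF // -eb -ex addr_gt0.
have -> : (q * r + q * k) ^+ 2 / q = q * (r + k) ^+ 2 by field; rewrite gt_eqF.
rewrite sqrrD -mulr_natl; rewrite -(ler_pM2l q0) in H.
by move: H; clear; lra.
Qed.

(** Titu's form of the Cauchy-Schwarz inequality bounds [a / y + b / z] by [s ^+ 2 / (y + z)], where
    [s] is the sum of the roots. Then [y + z] may be raised to [t], since [s ^+ 2 / d + d] decreases
    for [d <= s]. *)
Lemma titu y z a b t : 0 < y -> 0 < z -> 0 < a -> 0 < b -> y + z <= t ->
  t <= sqrt a + sqrt b -> (sqrt a + sqrt b) ^+ 2 / t + t <= a / y + y + (b / z + z).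
Proof.
move=> y0 z0 a0 b0 yz ts; set s := sqrt a + sqrt b.
have d0 : 0 < y + z by rewrite addr_gt0.
have t0 : 0 < t by apply: lt_le_trans yz.
have cs : s ^+ 2 / (y + z) <= a / y + b / z.
  rewrite ler_pdivrMr // /s.
  have ha := sqr_sqrtr (ltW a0); have hb := sqr_sqrtr (ltW b0).
  rewrite -{2}ha -{2}hb; set r := sqrt a; set k := sqrt b.
  rewrite -subr_ge0.
  have -> : (r ^+ 2 / y + k ^+ 2 / z) * (y + z) - (r + k) ^+ 2 =
      (r * z - k * y) ^+ 2 / (y * z) by field; rewrite !gt_eqF.
  by rewrite divr_ge0 ?sqr_ge0 // mulr_ge0 ?ltW.
have : s ^+ 2 / t + t <= s ^+ 2 / (y + z) + (y + z).
  rewrite -subr_ge0.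
  have -> : s ^+ 2 / (y + z) + (y + z) - (s ^+ 2 / t + t) =
     (t - (y + z)) * (s ^+ 2 - t * (y + z)) / (t * (y + z)) by field; rewrite !gt_eqF.
  rewrite divr_ge0 ?mulr_ge0 ?(ltW t0) ?(ltW d0) ?subr_ge0 //.
  by rewrite expr2 ler_pM // ?(ltW t0) ?(ltW d0) //; apply: le_trans ts.
by move: cs; clear; lra.
Qed.

End Scaled.

(** * Cost of the algorithm *)

Section Runs.
Variables (R : realType) (I : eqType) (A : I -> R).
Hypothesis A_gt0 : forall i, 0 < A i.
Implicit Types (s E : seq I) (a b l q T x : R) (p : R -> R).
Local Notation ar := (block_area A).
Local Notation sqrt := Num.sqrt.

Lemma split_sizes s s1 s2 : split_of A s s1 s2 ->
  [/\ (0 < size s1)%N, (0 < size s2)%N & size s = (size s1 + size s2)%N].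
Proof.
move=> [/perm_size + [n1 n2] _ _ _]; rewrite size_cat => ->.
by rewrite !lt0n !size_eq0.
Qed.

Lemma split_areas s s1 s2 : split_of A s s1 s2 ->
  [/\ 0 < ar s1, 0 < ar s2 & ar s = ar s1 + ar s2].
Proof.
move=> [/(perm_block_area A) -> [n1 n2] _ _ _]; rewrite block_area_cat.
by rewrite !block_area_gt0.
Qed.

Lemma split_dominant s s1 s2 : split_of A s s1 s2 -> 2 * ar s2 < ar s1 ->
  exists2 i, s1 = [:: i] & A i = ar s1.
Proof.
move=> sp; have [z1 z2 _] := split_sizes sp.
case: sp => _ _ _ _ [[h _ _] _] lt21.
have : (size s1 <= 1)%N by rewrite leqNgt; apply/negP => /h; lra.
case: s1 z1 {h lt21} => // i [] // _ _; exists i => //.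
by rewrite block_area_seq1.
Qed.

Lemma gapped_split s s1 s2 : split_of A s s1 s2 -> 2 * ar s2 < ar s1 -> gapped A s.
Proof.
move=> sp lt21; have [i s1E Ai] := split_dominant sp lt21.
have [p [_ n2] _ _ _] := sp; exists (A i).
by rewrite (perm_gap A _ p) s1E; apply: gap_cons => //; rewrite Ai.
Qed.

Lemma gap_catl t s1 s2 : gap A t s1 -> all (fun i => t <= A i) s2 -> gap A t (s1 ++ s2).
Proof.
move=> /and3P[h1 h2 h3] h; rewrite /gap !has_cat h1 h2 /=.
by rewrite low_sum_cat (low_sum_none h) addr0.
Qed.

Lemma nogap_split s s1 s2 : split_of A s s1 s2 -> ~ gapped A s ->
  [/\ ~ gapped A s1, ~ gapped A s2 & ar s1 <= 2 * ar s2].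
Proof.
move=> sp ng; have [p _ _ _ [[_ h12 _] [_ h21 _]]] := sp; split.
- move=> [t g]; apply: ng; exists t; rewrite (perm_gap A _ p).
  by apply: gap_catl => //; exact: h12.
- move=> [t g]; apply: ng; exists t; rewrite (perm_gap A _ p).
  have pc : perm_eq (s1 ++ s2) (s2 ++ s1) by rewrite perm_catC.
  rewrite (perm_gap A _ pc).
  by apply: gap_catl => //; exact: h21.
- by rewrite leNgt; apply/negP => lt21; apply: ng; exact: gapped_split sp lt21.
Qed.

(** Gaps on both sides would exclude each other: some [e] in [v] is below [t], some [z] in [u] is
    below a gap [t'] of [u], and [A e < t <= A z < t' <= A e]. Hence only one branch of the
    recursion has to be followed. *)
Lemma nogap_sibling t u v : sibling A u v -> gap A t v ->
  all (fun i => t <= A i) u -> ~ gapped A u.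
Proof.
move=> [_ huv _] /and3P[/hasP[e ev et] _ _] tu [t' g].
have := allP (huv _ g) _ ev; case/and3P: g => /hasP[z zu zt'] _ _.
by have := allP tu _ zu; lra.
Qed.

Lemma gapped_split_balanced s s1 s2 :
  split_of A s s1 s2 -> gapped A s -> ar s1 <= 2 * ar s2 ->
  exists u v, [/\ u = s1 /\ v = s2 \/ u = s2 /\ v = s1, gapped A v & ~ gapped A u].
Proof.
move=> sp [t]; have [p [n1 n2] _ le21 [h12 h21]] := sp.
have := block_area_ge0 A_gt0 s1; have := block_area_ge0 A_gt0 s2 => ge2 ge1.
rewrite (perm_gap A _ p) => /(gap_cat A_gt0 h12 h21).
case=> [[g h]|[g h]|[_ h _ _ lt]|[_ h _ _ lt]] le12.
- exists s2, s1; split; [by right | by exists t | exact: nogap_sibling g h].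
- exists s1, s2; split; [by left | by exists t | exact: nogap_sibling g h].
- by have := all_high_area A_gt0 h n2; lra.
- by have := all_high_area A_gt0 h n1; lra.
Qed.

(* Only the sides of a rectangle matter for the cost: [run s l q T] says that
   some execution on [s] and a rectangle with sides [q <= l] has cost [T]. *)
Inductive run : seq I -> R -> R -> R -> Prop :=
| RunSingle i l q : 0 < q -> q <= l -> l * q = A i -> run [:: i] l q (l + q)
| RunSplit s s1 s2 l q T1 T2 :
    0 < q -> q <= l -> l * q = ar s -> split_of A s s1 s2 ->
    run s1 (Num.max (ar s1 / q) q) (Num.min (ar s1 / q) q) T1 ->
    run s2 (Num.max (ar s2 / q) q) (Num.min (ar s2 / q) q) T2 ->
    run s l q (T1 + T2).

Definition cost p s : R := \sum_(i <- s) p (A i).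

(** Candidates for a lower bound on the perimeter of a piece of given area. The recursion is
    analyzed for all of them at once, so that it applies to [2 * sqrt a] as well as to [perim_lb]
    with various widths. *)
Definition admissible p : Prop := forall a, 0 < a -> 2 * sqrt a <= p a.

(* The second case is that of a strip of width [q] for a bound [p] which is
   exact on the pieces spanning the strip. *)
Definition fits p l q : Prop := l <= 3 * q \/ forall x, q <= x -> p (x * q) = x + q.

Local Notation cost0 := (cost (fun a => 2 * sqrt a)).

Lemma run_facts s l q T : run s l q T -> [/\ 0 < q, q <= l, l * q = ar s & s != [::]].
Proof.
case=> [i|{}s s1 s2] {}l {}q; first by move=> *; rewrite block_area_seq1.
move=> T1 T2 q0 ql e sp _ _; split=> //.
by have [z1 z2 z] := split_sizes sp; rewrite -size_eq0 z; lia.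
Qed.

Lemma run_single s l q T : run s l q T -> (size s <= 1)%N ->
  T = l + q /\ exists i, s = [:: i].
Proof.
case=> [i|{}s s1 s2] {}l {}q; first by split=> //; exists i.
move=> T1 T2 q0 ql e sp _ _.
by have [z1 z2 z] := split_sizes sp; rewrite z; lia.
Qed.

Lemma run_split s l q T : run s l q T -> (1 < size s)%N ->
  exists s1 s2 T1 T2, [/\ split_of A s s1 s2, T = T1 + T2,
    run s1 (Num.max (ar s1 / q) q) (Num.min (ar s1 / q) q) T1 &
    run s2 (Num.max (ar s2 / q) q) (Num.min (ar s2 / q) q) T2].
Proof.
case=> [i|{}s s1 s2] {}l {}q // T1 T2 q0 ql e sp r1 r2 _.
by exists s1, s2, T1, T2.
Qed.

Lemma cost_cat p s1 s2 : cost p (s1 ++ s2) = cost p s1 + cost p s2.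
Proof. by rewrite /cost big_cat. Qed.

Lemma cost_cons p i s : cost p (i :: s) = p (A i) + cost p s.
Proof. by rewrite /cost big_cons. Qed.

Lemma perm_cost p s1 s2 : perm_eq s1 s2 -> cost p s1 = cost p s2.
Proof. by move=> h; apply: perm_big. Qed.

Lemma cost_split p s s1 s2 : split_of A s s1 s2 -> cost p s = cost p s1 + cost p s2.
Proof. by move=> [/(perm_cost p) -> _ _ _ _]; rewrite cost_cat. Qed.

Lemma cost0_le p s : admissible p -> cost0 s <= cost p s.
Proof. by move=> adm; apply: ler_sum => i _; exact: adm. Qed.

(** A balanced cut keeps aspect ratios up to 3. In a longer rectangle each part is still at least
    [q] long, so its short side is again [q] and the exactness of [p] carries over. *)
Lemma fits_child p l q a b : 0 < q -> q <= l -> l * q = a + b -> a <= 2 * b ->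
  b <= 2 * a -> fits p l q -> fits p (Num.max (a / q) q) (Num.min (a / q) q).
Proof.
move=> q0 ql e ab ba; have qn0 : q != 0 by rewrite gt_eqF.
have lE : l = a / q + b / q by rewrite -mulrDl -e mulfK.
have ab' : a / q <= 2 * (b / q) by rewrite mulrA ler_pM2r ?invr_gt0.
have ba' : b / q <= 2 * (a / q) by rewrite mulrA ler_pM2r ?invr_gt0.
have /orP[l3|l3] := le_total l (3 * q).
  by move=> _; left; have /orP[h|h] := le_total (a / q) q;
    [rewrite max_r ?min_l|rewrite max_l ?min_r] => //; lra.
have h : q <= a / q by lra.
rewrite max_l ?min_r //.
by case=> [l3'|hp]; [left; lra | right].
Qed.

Lemma run_child_single s a q T : run s (Num.max (a / q) q) (Num.min (a / q) q) T ->
  (size s <= 1)%N -> T = a / q + q.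
Proof. by move=> r /(run_single r)[-> _]; rewrite addr_max_min. Qed.

Lemma cost_single p s : (0 < size s)%N -> (size s <= 1)%N -> cost p s = p (ar s).
Proof. by case: s => [|i []] //= _ _; rewrite /cost big_seq1 block_area_seq1. Qed.

Lemma long_side l q a b : 0 < q -> l * q = a + b -> a <= 2 * b -> b <= 2 * a ->
  3 * q <= l -> q * q <= a.
Proof.
move=> q0 e ab ba l3; have : 3 * q * q <= l * q by rewrite ler_pM2r.
by rewrite e; lra.
Qed.

Lemma wide_single p q a : 0 < q -> q * q <= a ->
  (forall x, q <= x -> p (x * q) = x + q) -> p a = a / q + q.
Proof.
move=> q0 h hp; rewrite -hp ?ler_pdivlMr // divfK // gt_eqF //.
Qed.

(** The surplus [sqrt (ar s) / 4] is reserved for a dominated neighbor. It survives the recursion by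
    subadditivity of the root when both parts are divided further, and by [scaled_single_child] and
    [scaled_pair] when single areas appear. *)
Lemma nogap_bound p s l q T : admissible p -> run s l q T -> ~ gapped A s ->
  fits p l q -> (1 < size s)%N -> T <= 1203/1000 * cost p s - sqrt (ar s) / 4.
Proof.
move=> adm; elim=> {s l q T} // s s1 s2 l q T1 T2 q0 ql e sp r1 IH1 r2 IH2 ng hf _.
have [ng1 ng2 le12] := nogap_split sp ng.
have [a0 b0 eS] := split_areas sp; have [z1 z2 _] := split_sizes sp.
have le21 : ar s2 <= 2 * ar s1 by case: sp => _ _ _; lra.
rewrite (cost_split p sp); rewrite eS in e *.
have f1 := fits_child q0 ql e le12 le21 hf.
have f2 : fits p (Num.max (ar s2 / q) q) (Num.min (ar s2 / q) q).
  by apply: (@fits_child p l q _ (ar s1)) => //; rewrite addrC.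
have {}IH1 := IH1 ng1 f1; have {}IH2 := IH2 ng2 f2.
have sq := sqrt_add_le (ltW a0) (ltW b0).
have [l3|[hp l3]] : l <= 3 * q \/ (forall x, q <= x -> p (x * q) = x + q) /\ 3 * q <= l.
    case: hf => [l3|hp]; first by left.
    by have /orP[l3|l3] := le_total l (3 * q); [left|right].
  have h1 : q * q <= ar s1 + ar s2 by rewrite -e ler_pM2r.
  have h2 : ar s1 + ar s2 <= 3 * (q * q) by rewrite -e mulrA ler_pM2r.
  have p1 := adm _ a0; have p2 := adm _ b0.
  have c1 := scaled_single_child q0 a0 b0 h1 h2 le12 le21.
  have c2 : ar s2 / q + q <= 1203/500 * sqrt (ar s2) - (sqrt (ar s1 + ar s2) - sqrt (ar s1)) / 4.
    by rewrite [ar s1 + _]addrC; apply: scaled_single_child; rewrite // addrC.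
  have pr := scaled_pair q0 a0 b0 h1 h2 le12 le21.
  have [sz1|sz1] := leqP (size s1) 1; have [sz2|sz2] := leqP (size s2) 1.
  - rewrite (run_child_single r1 sz1) (run_child_single r2 sz2).
    rewrite (cost_single p z1 sz1) (cost_single p z2 sz2).
    by move: p1 p2 pr; clear; lra.
  - have := IH2 sz2; rewrite (run_child_single r1 sz1) (cost_single p z1 sz1).
    by move: p1 c1; clear; lra.
  - have := IH1 sz1; rewrite (run_child_single r2 sz2) (cost_single p z2 sz2).
    by move: p2 c2; clear; lra.
  - have := IH1 sz1; have := IH2 sz2; move: sq; clear; lra.
have q1 := long_side q0 e le12 le21 l3.
have q2 : q * q <= ar s2 by apply: (long_side q0 _ le21 le12 l3); rewrite addrC.
(* In a long rectangle every part has area at least [q * q], where [p] is exact; [203/1000] of its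
   perimeter is at least [406/1000] of its root, more than the quarter required. *)
have single s' T' : (0 < size s')%N -> (size s' <= 1)%N -> q * q <= ar s' ->
    run s' (Num.max (ar s' / q) q) (Num.min (ar s' / q) q) T' ->
    T' <= 1203/1000 * cost p s' - sqrt (ar s') / 4.
  move=> z sz qs r; rewrite (run_child_single r sz) (cost_single p z sz).
  have s0 : 0 < ar s' by apply: lt_le_trans qs; rewrite mulr_gt0.
  have := sqrt_perim q0 s0; rewrite (wide_single q0 qs hp).
  by have := sqrtr_ge0 (ar s'); clear; lra.
have : T1 <= 1203/1000 * cost p s1 - sqrt (ar s1) / 4.
  by have [sz1|sz1] := leqP (size s1) 1; [exact: single | exact: IH1].
have : T2 <= 1203/1000 * cost p s2 - sqrt (ar s2) / 4.
  by have [sz2|sz2] := leqP (size s2) 1; [exact: single | exact: IH2].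
by move: sq; clear; lra.
Qed.

End Runs.

(** * Error bounds for dominated blocks *)

Section Dominated.
Variables (R : realType) (I : eqType) (A : I -> R).
Hypothesis A_gt0 : forall i, 0 < A i.
Implicit Types (s E : seq I) (a b l q T x : R) (p : R -> R).
Local Notation ar := (block_area A).
Local Notation sqrt := Num.sqrt.
Local Notation run := (run A).
Local Notation cost := (cost A).
Local Notation cost0 := (cost (fun a => 2 * sqrt a)).

Lemma ratio_child l q a b : 0 < q -> q <= l -> l * q = a + b -> a <= 2 * b ->
  b <= 2 * a -> l <= 3 * q -> Num.max (a / q) q <= 3 * Num.min (a / q) q.
Proof.
move=> q0 ql e ab ba l3.
have lE : l = a / q + b / q by rewrite -mulrDl -e mulfK // gt_eqF.
have ab' : a / q <= 2 * (b / q) by rewrite mulrA ler_pM2r ?invr_gt0.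
have ba' : b / q <= 2 * (a / q) by rewrite mulrA ler_pM2r ?invr_gt0.
by have /orP[h|h] := le_total (a / q) q; [rewrite max_r ?min_l|rewrite max_l ?min_r] => //; lra.
Qed.

Lemma maxMmin a q : 0 < q -> Num.max (a / q) q * Num.min (a / q) q = a.
Proof.
move=> q0; have qn0 : q != 0 by rewrite gt_eqF.
have /orP[h|h] := le_total (a / q) q.
  by rewrite max_r ?min_l // mulrC divfK.
by rewrite max_l ?min_r // divfK.
Qed.

Lemma min_le_max a b : Num.min a b <= Num.max a b.
Proof. by rewrite ge_min le_max lexx. Qed.

Lemma split_size_gt1 s s1 s2 : split_of A s s1 s2 -> (1 < size s)%N.
Proof. by move=> /split_sizes[z1 z2 ->]; rewrite -addn1 leq_add. Qed.

(** Up to aspect ratio 3 this restates [nogap_bound] by [scaled_nogap_slack]. In a longer rectangle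
    two errors [6/5 * q] meet, and splitting the root gains at least [6/5 * q], so one of them
    cancels. *)
Lemma nogap_thin_bound s l q T : run s l q T -> ~ gapped A s ->
  T <= 1203/1000 * cost0 s + l + 6/5 * q - 1203/500 * sqrt (ar s).
Proof.
elim=> {s l q T} [i l q q0 ql e _|s s1 s2 l q T1 T2 q0 ql e sp r1 IH1 r2 IH2 ng].
  by rewrite (cost_single A _ (erefl : (0 < size [:: i])%N)) //; move: q0; clear; lra.
have [ng1 ng2 le12] := nogap_split A_gt0 sp ng.
have [a0 b0 eS] := split_areas A_gt0 sp.
have le21 : ar s2 <= 2 * ar s1 by case: sp => _ _ _ + _; move: a0; clear; lra.
have /orP[l3|l3] := le_total l (3 * q).
  have hr := RunSplit q0 ql e sp r1 r2.
  have sz := split_size_gt1 sp.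
  have s0 : 0 < ar s by rewrite eS addr_gt0.
  have := nogap_bound (p := fun a => 2 * sqrt a) A_gt0 (fun _ _ => lexx _) hr ng (or_introl l3) sz.
  have := scaled_nogap_slack q0 s0; rewrite -{2}e mulfK ?gt_eqF //.
  by clear; lra.
have q1 := long_side q0 (etrans e eS) le12 le21 l3.
have q2 : q * q <= ar s2 by apply: (long_side q0 _ le21 le12 l3); rewrite e eS addrC.
have := IH1 ng1; have := IH2 ng2.
rewrite !max_l ?min_r ?ler_pdivlMr // (cost_split _ sp) eS.
have lE : l = ar s1 / q + ar s2 / q by rewrite -mulrDl -eS -e mulfK // gt_eqF.
have h3 : 3 * (q * q) <= ar s1 + ar s2 by rewrite -eS -e mulrA ler_pM2r.
have := sqrt_split_gain q0 a0 b0 le12 le21 h3.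
by rewrite lE; clear; lra.
Qed.

(* The first cut separates the dominating area [i] from the rest [E]. *)
Definition dominated s l q T i E : Prop :=
  [/\ E != [::], perm_eq s (i :: E), 2 * ar E < A i &
      exists2 TE, run E (Num.max (ar E / q) q) (Num.min (ar E / q) q) TE &
                  T = A i / q + q + TE].

(* The first cut separates [i] from a block [v] dominated by [j]. *)
Definition next_dominated s l q T i v j E : Prop :=
  [/\ perm_eq s (i :: v), A i <= 2 * ar v, sibling A v [:: i] &
      exists2 Tv, dominated v (Num.max (ar v / q) q) (Num.min (ar v / q) q) Tv j E &
                  T = A i / q + q + Tv].

Definition truncated p q : Prop := forall x, q <= x -> p (x * q) = x + q.

(* The bounds allow for one wall between a dominating area and the rest. *)
Definition thin_bound s : Prop := forall l q T, run s l q T ->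
  T <= 1203/1000 * cost0 s + l + 2 * q - 1203/500 * sqrt (ar s).

Definition wide_bound s : Prop := forall p l q T, admissible p -> truncated p q ->
  run s l q T -> T <= 1203/1000 * cost p s + 3/5 * q.

Lemma dominated_area s l q T i E (dom : dominated s l q T i E) : ar s = A i + ar E.
Proof. by have [_ ps _ _] := dom; rewrite (perm_block_area _ ps) block_area_cons. Qed.

Lemma dominated_length s l q T i E (q_gt0 : 0 < q) (area_s : l * q = ar s)
    (dom : dominated s l q T i E) : l = A i / q + ar E / q.
Proof. by rewrite -mulrDl -(dominated_area dom) -area_s mulfK // gt_eqF. Qed.

Lemma dominated_cost p s l q T i E (dom : dominated s l q T i E) : cost p s = p (A i) + cost p E.
Proof. by have [_ ps _ _] := dom; rewrite (perm_cost _ _ ps) cost_cons. Qed.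

Lemma dominated_rest_gt0 s l q T i E (dom : dominated s l q T i E) : 0 < ar E.
Proof. by have [n0 _ _ _] := dom; exact: block_area_gt0. Qed.

Lemma dominated_rest_bound s l q T i E (q_gt0 : 0 < q) (area_s : l * q = ar s)
    (dom : dominated s l q T i E) (thinE : thin_bound E) :
  T <= 1203/1000 * cost0 s + l + 2 * q + Num.min (ar E / q) q
       - 1203/500 * (sqrt (A i) + sqrt (ar E)).
Proof.
have [_ _ _ [TE /thinE rE ->]] := dom.
have := addr_max_min (ar E / q) q.
by rewrite (dominated_cost _ dom) (dominated_length q_gt0 area_s dom); move: rE; clear; lra.
Qed.

(** This is why nested dominating areas do not accumulate walls: the additional wall is at most
    [sqrt (ar E)], and splitting the root of [ar s] gains [16/10 * sqrt (ar E)]. *)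
Lemma dominated_thin s l q T i E (q_gt0 : 0 < q) (area_s : l * q = ar s)
    (dom : dominated s l q T i E) (thinE : thin_bound E) :
  T <= 1203/1000 * cost0 s + l + 2 * q - 1203/500 * sqrt (ar s).
Proof.
have [_ _ Ei _] := dom; have E0 := dominated_rest_gt0 dom.
have := scaled_dominant_gain (A_gt0 i) E0 (ltW Ei); rewrite -(dominated_area dom).
have : Num.min (ar E / q) q <= sqrt (ar E).
  have /orP[h|h] := le_total (ar E) (q * q).
    by rewrite ge_min div_le_sqrt.
  by rewrite ge_min; apply/orP; right; exact: le_sqrt_scale.
by have := dominated_rest_bound q_gt0 area_s dom thinE; have := sqrtr_ge0 (ar E); clear; lra.
Qed.

(** The extra term is the [D] of the inequalities above. Multiplied by [sqrt (ar s)] it is [ar E],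
    which bounds the amount by which a dominated block can exceed a sibling of area at least
    [A i]. *)
Lemma dominated_thin_gain s l q T i E (q_gt0 : 0 < q) (area_s : l * q = ar s)
    (dom : dominated s l q T i E) (thinE : thin_bound E) : l <= 3 * q ->
  T <= 1203/1000 * cost0 s + l + 2 * q - 1203/500 * sqrt (ar s)
       - ar E / sqrt (ar s).
Proof.
move=> l3; have [_ _ Ei _] := dom; have E0 := dominated_rest_gt0 dom.
have s3 : A i + ar E <= 3 * (q * q) by rewrite -(dominated_area dom) -area_s mulrA ler_pM2r.
have := scaled_dominant_long q_gt0 (A_gt0 i) E0 (ltW Ei) s3; rewrite -(dominated_area dom).
have : Num.min (ar E / q) q <= ar E / q by rewrite ge_min lexx.
by have := dominated_rest_bound q_gt0 area_s dom thinE; clear; lra.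
Qed.

(** The origin of [3/5]: a thin rest costs a wall of length [q], and if [A i >= q * q] the exactness
    of [p] returns [203/1000] of a perimeter of at least [2 * q]. For smaller [A i] the term
    [2/5 * sqrt (ar E)], left over from [thin_bound], makes up the difference. *)
Lemma dominated_wide p s l q T i E (q_gt0 : 0 < q) (le_ql : q <= l)
    (area_s : l * q = ar s) (dom : dominated s l q T i E) (thinE : thin_bound E) :
  admissible p -> truncated p q -> wide_bound E ->
  T <= 1203/1000 * cost p s + 3/5 * q.
Proof.
move=> adm tr wideE; have [n0 _ Ei [TE rE ->]] := dom; have E0 := dominated_rest_gt0 dom.
have qn0 : q != 0 by rewrite gt_eqF.
rewrite (dominated_cost _ dom); have Ai0 := A_gt0 i.
have e : ar s = A i + ar E := dominated_area dom.
have qs : q * q <= A i + ar E by rewrite -e -area_s ler_pM2r.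
have thin : ar E <= q * q -> TE <= 1203/1000 * cost p E + (q - 2/5 * sqrt (ar E)).
  move=> h; have := thinE _ _ _ rE; have := cost0_le A_gt0 E adm.
  have := div_le_sqrt q_gt0 E0 h; have := sqrtr_ge0 (ar E).
  have hE : ar E / q <= q by rewrite ler_pdivrMr.
  by rewrite (max_r hE) (min_l hE); clear; lra.
have /orP[h|h] := le_total (q * q) (A i).
  rewrite (wide_single q_gt0 h tr).
  have : q <= A i / q by rewrite ler_pdivlMr.
  have /orP[h'|h'] := le_total (ar E) (q * q).
    by have := thin h'; have := sqrtr_ge0 (ar E); move: q_gt0; clear; lra.
  have hE : q <= ar E / q by rewrite ler_pdivlMr.
  move: rE; rewrite (max_l hE) (min_r hE) => rE.
  by have := wideE _ _ _ _ adm tr rE; move: q_gt0; clear; lra.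
have h' : ar E <= q * q by move: h Ei Ai0; clear; lra.
have hh : 2 * (q * q) <= 3 * A i by move: qs Ei; clear; lra.
have := scaled_dominant_wide q_gt0 Ai0 E0 hh h h' qs.
by have := thin h'; have := adm _ Ai0; clear; lra.
Qed.

End Dominated.

(** * Dominated blocks next to other pieces *)

Section Combination.
Variables (R : realType) (I : eqType) (A : I -> R).
Hypothesis A_gt0 : forall i, 0 < A i.
Implicit Types (s E u v w : seq I) (a b d l q T x : R) (p : R -> R).
Local Notation ar := (block_area A).
Local Notation sqrt := Num.sqrt.
Local Notation run := (run A).
Local Notation cost := (cost A).
Local Notation cost0 := (cost (fun a => 2 * sqrt a)).
Local Notation dominated := (dominated A).
Local Notation next_dominated := (next_dominated A).
Local Notation thin_bound := (thin_bound A).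
Local Notation wide_bound := (wide_bound A).

Lemma nogap_le p s l q T : admissible p -> run s l q T -> ~ gapped A s ->
  fits p l q -> T <= 1203/1000 * cost p s.
Proof.
move=> adm r ng hf; have [q0 ql e n0] := run_facts r.
have s0 := block_area_gt0 A_gt0 n0.
have [sz|sz] := ltnP 1 (size s).
  have := nogap_bound A_gt0 adm r ng hf sz.
  by have := sqrtr_ge0 (ar s); clear; lra.
have [-> _] := run_single r sz.
rewrite (cost_single A p) ?lt0n ?size_eq0 //.
case: hf => [l3|tr].
  have h1 : q * q <= 3 * ar s.
    by have : q * q <= l * q; [rewrite ler_pM2r|rewrite e; move: s0; clear; lra].
  have h2 : ar s <= 3 * (q * q) by rewrite -e mulrA ler_pM2r.
  have := scaled_single_le q0 s0 h1 h2; have := adm _ s0.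
  by rewrite -{3}e mulfK ?gt_eqF //; clear; lra.
by rewrite -e tr //; move: q0 ql; clear; lra.
Qed.

Lemma fits_case p l q : fits p l q -> l <= 3 * q \/ truncated p q /\ 3 * q <= l.
Proof.
case=> [l3|tr]; first by left.
by have /orP[l3|l3] := le_total l (3 * q); [left|right].
Qed.

(** A piece spanning a strip of width [q] leaves a surplus [d * q] for its neighbors. In the
    instances below the digits of the name give the least area as a fraction of [q * q], and [x] is
    a rational number just below the root of that fraction. *)
Lemma wide_piece p q a x d : admissible p -> truncated p q -> 0 < q -> 0 < a ->
  0 <= x -> x <= 1 -> x ^+ 2 * (q * q) <= a -> d <= 2/5 ->
  x ^+ 2 + 1 + d <= 1203/500 * x -> a / q + q + d * q <= 1203/1000 * p a.
Proof.
move=> adm tr q0 a0 x0 x1 xa d1 xd.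
have /orP[h|h] := le_total a (q * q).
  by have := scaled_wide_le q0 a0 x0 x1 xa h d1 xd; have := adm _ a0; clear; lra.
rewrite (wide_single q0 h tr); have : q <= a / q by rewrite ler_pdivlMr.
have : d * q <= 2/5 * q by rewrite ler_pM2r.
by move: q0; clear; lra.
Qed.

Lemma wide_piece1 p q a : admissible p -> truncated p q -> 0 < q -> 0 < a ->
  q * q <= a -> a / q + q + 2/5 * q <= 1203/1000 * p a.
Proof. by move=> adm tr q0 a0 h; apply: (@wide_piece _ _ _ (1)) => //; lra. Qed.

Lemma wide_piece67 p q a : admissible p -> truncated p q -> 0 < q -> 0 < a ->
  6 * (q * q) <= 7 * a -> a / q + q + 73/200 * q <= 1203/1000 * p a.
Proof. by move=> adm tr q0 a0 h; apply: (@wide_piece _ _ _ (37/40)) => //; lra. Qed.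

Lemma wide_piece23 p q a : admissible p -> truncated p q -> 0 < q -> 0 < a ->
  2 * (q * q) <= 3 * a -> a / q + q + 29/100 * q <= 1203/1000 * p a.
Proof. by move=> adm tr q0 a0 h; apply: (@wide_piece _ _ _ (13/16)) => //; lra. Qed.

Lemma wide_piece47 p q a : admissible p -> truncated p q -> 0 < q -> 0 < a ->
  4 * (q * q) <= 7 * a -> a / q + q + 24/100 * q <= 1203/1000 * p a.
Proof. by move=> adm tr q0 a0 h; apply: (@wide_piece _ _ _ (3/4)) => //; lra. Qed.

Lemma all_high_area2 t s : all (fun i => t <= A i) s -> (1 < size s)%N -> 2 * t <= ar s.
Proof.
case: s => [|i [|j s]] //= /and3P[ti tj _] _; rewrite !block_area_cons.
by have := block_area_ge0 A_gt0 s; move: ti tj; clear; lra.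
Qed.

(* Three pieces of area at least [A i] do not fit into twice the area of [v]. *)
Lemma pair_of_high u l q T i : run u l q T -> (1 < size u)%N ->
  all (fun k => A i <= A k) u -> ar u < 3 * A i -> ~ gapped A u ->
  exists a b, [/\ [/\ 0 < a, 0 < b & ar u = a + b], A i <= a /\ A i <= b,
    a <= 2 * b /\ b <= a,
    T = a / q + q + (b / q + q) & forall p, cost p u = p a + p b].
Proof.
move=> r sz hi lt3 ng; have [u1 [u2 [T1 [T2 [sp -> r1 r2]]]]] := run_split r sz.
have [z1 z2 _] := split_sizes sp; have [a0 b0 e] := split_areas A_gt0 sp.
have [_ _ le12] := nogap_split A_gt0 sp ng.
have [pu [n1 n2] _ le21 _] := sp.
move: hi; rewrite (perm_all _ pu) all_cat => /andP[hi1 hi2].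
have h1 := all_high_area A_gt0 hi1 n1; have h2 := all_high_area A_gt0 hi2 n2.
have sz1 : (size u1 <= 1)%N.
  by rewrite leqNgt; apply/negP => /(all_high_area2 hi1); move: lt3 h2; rewrite e; clear; lra.
have sz2 : (size u2 <= 1)%N.
  by rewrite leqNgt; apply/negP => /(all_high_area2 hi2); move: lt3 h1; rewrite e; clear; lra.
exists (ar u1), (ar u2); split=> //.
  by rewrite (run_child_single r1) // (run_child_single r2).
by move=> p; rewrite (cost_split p sp) !(cost_single A p).
Qed.

(** Since [ar u <= 2 * ar v < 3 * A i], the block [u] is a pair. Up to aspect ratio 3 the gain of
    [dominated_thin_gain] covers the excess of [ar v] over half of the pair; beyond it the pair
    supplies a surplus of more than [3/5 * q]. *)
Lemma pair_over_dominated p u v l q Tu Tv i E : admissible p -> fits p l q ->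
  0 < q -> q <= l -> l * q = ar u + ar v -> ar u <= 2 * ar v -> ar v <= 2 * ar u ->
  ~ gapped A u -> (1 < size u)%N -> all (fun k => A i <= A k) u ->
  run u (Num.max (ar u / q) q) (Num.min (ar u / q) q) Tu ->
  dominated v (Num.max (ar v / q) q) (Num.min (ar v / q) q) Tv i E ->
  thin_bound E -> wide_bound E ->
  Tu + Tv <= 1203/1000 * (cost p u + cost p v).
Proof.
move=> adm hf q0 ql e uv vu ng sz hi ru dv tE wE.
have Ai0 := A_gt0 i; have E0 := dominated_rest_gt0 A_gt0 dv.
have vE := dominated_area dv; have [_ _ Ei _] := dv.
have v0 : 0 < ar v by rewrite vE addr_gt0.
have lt3 : ar u < 3 * A i by move: uv Ei; rewrite vE; clear; lra.
have [a [b [[a0 b0 eu] [ia ib] [ab ba] -> cu]]] := pair_of_high ru sz hi lt3 ng.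
have u0 : 0 < ar u by rewrite eu addr_gt0.
have ba2 : b <= 2 * a by move: ba a0; clear; lra.
set L := Num.max (ar v / q) q in dv *; set S := Num.min (ar v / q) q in dv *.
have S0 : 0 < S by rewrite /S lt_min divr_gt0.
have SL : S <= L := min_le_max _ _.
have LS : L * S = ar v := maxMmin _ q0.
have [l3|[tr l3]] := fits_case hf.
  have L3 : L <= 3 * S by apply: (@ratio_child _ l q _ (ar u)) => //; rewrite addrC.
  have := dominated_thin_gain A_gt0 S0 LS dv tE L3.
  have h1 : q * q <= a + b + ar v by rewrite -eu -e ler_pM2r.
  have h2 : a + b + ar v <= 3 * (q * q) by rewrite -eu -e mulrA ler_pM2r.
  have D0 : 0 <= ar E / sqrt (ar v) by rewrite divr_ge0 ?sqrtr_ge0 // ltW.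
  have hD : ar v - (a + b) / 2 <= ar E / sqrt (ar v) * sqrt (ar v).
    by rewrite divfK ?gt_eqF ?sqrtr_gt0 // vE; move: ia ib; clear; lra.
  have h3 : a + b <= 2 * ar v by rewrite -eu.
  have h4 : 4 * ar v <= 3 * (a + b) by rewrite vE; move: ia ib Ei; clear; lra.
  have := scaled_pair_dominant q0 a0 b0 v0 ab ba2 h3 h4 h1 h2 D0 hD (erefl _).
  rewrite -/L -/S -eu; have := cost0_le A_gt0 v adm.
  by rewrite cu; have := adm _ a0; have := adm _ b0; clear; lra.
have q1 := long_side q0 e uv vu l3.
have q2 : q * q <= ar v by apply: (long_side q0 _ vu uv l3); rewrite addrC.
have qu : q <= ar u / q by rewrite ler_pdivlMr.
have qv : q <= ar v / q by rewrite ler_pdivlMr.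
have SE : S = q by rewrite /S min_r.
have wv : Tv <= 1203/1000 * cost p v + 3/5 * S.
  apply: (dominated_wide A_gt0 _ SL LS dv tE) => //; first by rewrite SE.
have l3' : 3 * (q * q) <= ar u + ar v by rewrite -e mulrA ler_pM2r.
have h4 : 4 * ar v <= 3 * ar u by rewrite vE eu; move: ia ib Ei; clear; lra.
(* The pair has area at least [12/7 * (q * q)], its larger member at least one half and its smaller
   one at least one third of that. The surpluses [73/200] and [24/100] add up to more than [3/5]. *)
have wa : a / q + q + 73/200 * q <= 1203/1000 * p a.
  by apply: wide_piece67 => //; move: l3' h4 ba; rewrite eu; clear; lra.
have wb : b / q + q + 24/100 * q <= 1203/1000 * p b.
  by apply: wide_piece47 => //; move: l3' h4 ab; rewrite eu; clear; lra.
by rewrite (min_r qu) cu; move: wv wa wb q0; rewrite SE; clear; lra.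
Qed.

Lemma next_dominated_facts v l q T i w j E : next_dominated v l q T i w j E ->
  [/\ ar v = A i + ar w, ar w = A j + ar E, 0 < ar E,
      A j <= A i /\ 2 * ar E < A j & A i <= 2 * ar w /\ ar w <= 2 * A i].
Proof.
move=> [pv iw [sib1 sib2 _] [Tw dw _]].
have E0 := dominated_rest_gt0 A_gt0 dw; have wE := dominated_area dw.
have [En0 pw Ej _] := dw; split=> //.
- by rewrite (perm_block_area _ pv) block_area_cons.
- split=> //; have : gap A (A j) w by rewrite (perm_gap A _ pw); exact: gap_cons.
  by move=> /sib2 /=; rewrite andbT.
- split=> //; rewrite -(block_area_seq1 A i); apply: sib1.
  by rewrite (perm_size pw) /= ltnS lt0n size_eq0.
Qed.

Lemma next_dominated_sibling v u l q T i w j E : next_dominated v l q T i w j E ->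
  sibling A v u -> A i <= ar u /\ ar w <= ar u.
Proof.
move=> nd [_ _ sib]; have [_ wE _ [ji Ej] _] := next_dominated_facts nd.
have [pv _ _ [Tw [En0 pw _ _] _]] := nd; rewrite wE; apply: sib => //.
by apply: perm_trans pv _; rewrite perm_cons.
Qed.

(** Up to aspect ratio 3, a divided [u] pays with the surplus [sqrt (ar u) / 4] of [nogap_bound],
    while a single area [u] leads to the extremal configuration of three parts, settled by
    [scaled_three]. *)
Lemma over_next_dominated p u v l q Tu Tv i w j E : admissible p -> fits p l q ->
  0 < q -> q <= l -> l * q = ar u + ar v -> ar u <= 2 * ar v -> ar v <= 2 * ar u ->
  ~ gapped A u -> sibling A v u ->
  run u (Num.max (ar u / q) q) (Num.min (ar u / q) q) Tu ->
  next_dominated v (Num.max (ar v / q) q) (Num.min (ar v / q) q) Tv i w j E ->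
  thin_bound E -> wide_bound E ->
  Tu + Tv <= 1203/1000 * (cost p u + cost p v).
Proof.
move=> adm hf q0 ql e uv vu ng sib ru nv tE wE.
have [vE wEq E0 [ji Ej] [iw wi]] := next_dominated_facts nv.
have [iu wu] := next_dominated_sibling nv sib.
have i0 := A_gt0 i; have j0 := A_gt0 j.
have [pv _ _ [Tw dw ->]] := nv; rewrite (perm_cost A p pv) cost_cons.
have w0 : 0 < ar w by rewrite wEq addr_gt0.
have v0 : 0 < ar v by rewrite vE addr_gt0.
have u0 : 0 < ar u by apply: lt_le_trans iu.
have w3 : 2 * ar w <= 3 * A i by rewrite wEq; move: ji Ej; clear; lra.
have wiE : ar w - A i <= ar E by rewrite wEq; move: ji; clear; lra.
have c0w := cost0_le A_gt0 w adm; have adi := adm _ i0; have adu := adm _ u0.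
have [_ _ _ un0] := run_facts ru.
have su0 : (0 < size u)%N by rewrite lt0n size_eq0.
set L := Num.max (ar v / q) q in nv dw *; set S := Num.min (ar v / q) q in nv dw *.
have S0 : 0 < S by rewrite /S lt_min divr_gt0.
have SL : S <= L := min_le_max _ _.
have LS : L * S = ar v := maxMmin _ q0.
set L' := Num.max (ar w / S) S in dw; set S' := Num.min (ar w / S) S in dw.
have S'0 : 0 < S' by rewrite /S' lt_min divr_gt0.
have SL' : S' <= L' := min_le_max _ _.
have LS' : L' * S' = ar w := maxMmin _ S0.
have D0 : 0 <= ar E / sqrt (ar w) by rewrite divr_ge0 ?sqrtr_ge0 // ltW.
have hD : ar w - A i <= ar E / sqrt (ar w) * sqrt (ar w).
  by rewrite divfK ?gt_eqF ?sqrtr_gt0.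
have gain : L <= 3 * S ->
    Tw <= 1203/1000 * cost0 w + L' + 2 * S' - 1203/500 * sqrt (ar w) - ar E / sqrt (ar w).
  move=> L3; apply: (dominated_thin_gain A_gt0 S'0 LS' dw tE).
  by apply: (@ratio_child _ L S _ (A i)) => //; rewrite LS vE addrC.
have small : L <= 3 * S ->
    A i / S + S + Tw <= 1203/1000 * (p (A i) + cost p w) + sqrt (ar u) / 4.
  move=> L3; have := gain L3.
  have h1 : S * S <= A i + ar w by rewrite -vE -LS ler_pM2r.
  have h2 : A i + ar w <= 3 * (S * S) by rewrite -vE -LS mulrA ler_pM2r.
  have := scaled_two S0 i0 w0 iw w3 h1 h2 iu wu D0 hD.
  by rewrite -/L' -/S'; move: c0w adi; clear; lra.
have [sz|sz] := ltnP 1 (size u).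
  have fu : fits p (Num.max (ar u / q) q) (Num.min (ar u / q) q).
    exact: (@fits_child _ p l q _ (ar v)).
  have nu := nogap_bound A_gt0 adm ru ng fu sz.
  have /orP[L3|L3] := le_total L (3 * S).
    by have := small L3; move: nu; clear; lra.
  have [l3|[tr l3]] := fits_case hf.
    have L3' : L <= 3 * S by apply: (@ratio_child _ l q _ (ar u)) => //; rewrite addrC.
    by have := small L3'; move: nu; clear; lra.
  have q2 : q * q <= ar v by apply: (long_side q0 _ vu uv l3); rewrite addrC.
  have qv : q <= ar v / q by rewrite ler_pdivlMr.
  have SE : S = q by rewrite /S min_r.
  have qi : q * q <= A i by rewrite -SE; apply: (@long_side _ L _ _ (ar w)) => //; rewrite LS vE.
  have qw : q * q <= ar w.
    by rewrite -SE; apply: (@long_side _ L _ _ (A i)) => //; rewrite LS vE addrC.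
  have qwd : S <= ar w / S by rewrite ler_pdivlMr // SE.
  have S'E : S' = q by rewrite /S' min_r.
  have trS' : truncated p S' by rewrite S'E.
  have := dominated_wide A_gt0 S'0 SL' LS' dw tE adm trS' wE.
  (* The surplus [2/5 * q] of [i] and the surplus of [u], at least [q / 4], exceed the error
     [3/5 * q] of the dominated block. *)
  have := wide_piece1 adm tr q0 i0 qi.
  have := le_sqrt_scale q0 (le_trans qw wu).
  by rewrite S'E SE; move: nu q0; clear; lra.
rewrite (run_child_single ru sz) (cost_single A p su0 sz).
have [l3|[tr l3]] := fits_case hf.
  have L3 : L <= 3 * S by apply: (@ratio_child _ l q _ (ar u)) => //; rewrite addrC.
  have h1 : q * q <= ar u + A i + ar w by rewrite -addrA -vE -e ler_pM2r.
  have h2 : ar u + A i + ar w <= 3 * (q * q) by rewrite -addrA -vE -e mulrA ler_pM2r.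
  have h3 : ar u <= 2 * (A i + ar w) by rewrite -vE.
  have SE : S = Num.min ((A i + ar w) / q) q by rewrite /S vE.
  have := scaled_three q0 u0 i0 w0 iu wu iw w3 h3 h1 h2 D0 hD SE.
  by have := gain L3; rewrite -/L' -/S'; move: c0w adi adu; clear; lra.
have q1 := long_side q0 e uv vu l3.
have q2 : q * q <= ar v by apply: (long_side q0 _ vu uv l3); rewrite addrC.
have qv : q <= ar v / q by rewrite ler_pdivlMr.
have SE : S = q by rewrite /S min_r.
have pu := wide_piece1 adm tr q0 u0 q1.
rewrite SE; have q2' : q * q <= A i + ar w by rewrite -vE.
have /orP[qw|qw] := le_total (q * q) (ar w).
  have qwd : S <= ar w / S by rewrite ler_pdivlMr // SE.
  have S'E : S' = q by rewrite /S' min_r.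
  have trS' : truncated p S' by rewrite S'E.
  have := dominated_wide A_gt0 S'0 SL' LS' dw tE adm trS' wE.
  have qi : 2 * (q * q) <= 3 * A i by move: w3 qw; clear; lra.
  have := wide_piece23 adm tr q0 i0 qi.
  by rewrite S'E; move: pu q0; clear; lra.
have := dominated_thin A_gt0 S'0 LS' dw tE.
have wq : ar w / q <= q by rewrite ler_pdivrMr.
rewrite /L' /S' SE (max_r wq) (min_l wq).
have /orP[qi|qi] := le_total (q * q) (A i).
  have q4 : q * q <= 4 * ar w by move: iw qi w0; clear; lra.
  have := wide_piece1 adm tr q0 i0 qi; have := scaled_thin_dominant q0 w0 q4 qw.
  by move: c0w pu q0; clear; lra.
have := scaled_thin q0 i0 w0 iw w3 q2' qi qw.
by move: c0w adi pu; clear; lra.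
Qed.

End Combination.

(** * Simultaneous induction for the two error bounds *)

Section Induction.
Variables (R : realType) (I : eqType) (A : I -> R).
Hypothesis A_gt0 : forall i, 0 < A i.
Implicit Types (s E u v w : seq I) (a b d l q T x : R) (p : R -> R).
Local Notation ar := (block_area A).
Local Notation sqrt := Num.sqrt.
Local Notation run := (run A).
Local Notation cost := (cost A).
Local Notation cost0 := (cost (fun a => 2 * sqrt a)).
Local Notation dominated := (dominated A).
Local Notation next_dominated := (next_dominated A).
Local Notation thin_bound := (thin_bound A).
Local Notation wide_bound := (wide_bound A).

Lemma admissible_sqrt : admissible (fun a : R => 2 * sqrt a).
Proof. by []. Qed.

Lemma single_nogap i : ~ gapped A [:: i].
Proof.
by move=> [t]; rewrite /gap /= !orbF => /and3P[a]; rewrite leNgt a.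
Qed.

Lemma gapped_run s l q T : run s l q T -> gapped A s ->
  (exists i E, dominated s l q T i E) \/
  exists u v Tu Tv,
    [/\ [/\ perm_eq s (u ++ v), ar u <= 2 * ar v & ar v <= 2 * ar u],
        gapped A v /\ ~ gapped A u, sibling A u v /\ sibling A v u,
        run u (Num.max (ar u / q) q) (Num.min (ar u / q) q) Tu /\
        run v (Num.max (ar v / q) q) (Num.min (ar v / q) q) Tv & T = Tu + Tv].
Proof.
case=> [i|{}s s1 s2] {}l {}q; first by move=> _ _ _ /single_nogap.
move=> T1 T2 q0 ql e sp r1 r2 gs.
have [a0 b0 _] := split_areas A_gt0 sp; have [p [n1 n2] _ le21 [sb12 sb21]] := sp.
have [lt21|le12] := ltP (2 * ar s2) (ar s1).
  left; have [i s1E Ai] := split_dominant sp lt21; exists i, s2; split=> //.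
  - by rewrite s1E in p.
  - by rewrite Ai.
  exists T2 => //; rewrite Ai (run_child_single r1) ?s1E //.
right; have [u [v [[[-> ->]|[-> ->]] gv gu]]] := gapped_split_balanced A_gt0 sp gs le12.
  by exists s1, s2, T1, T2; split=> //; split=> //; move: le21 a0; clear; lra.
exists s2, s1, T2, T1; split; rewrite 1?addrC //; split=> //.
  by rewrite (permPl p) perm_catC.
by move: le21 a0; clear; lra.
Qed.

(** The recursion follows the half that carries the gap. Two single areas above a dominated block,
    or a sibling that is not a single area, already pay for the wall, and the bound then persists
    upwards. The bounds for shorter lists are a hypothesis because the lemma also serves to prove
    them. *)
Lemma gapped_trichotomy p s l q T : admissible p -> run s l q T -> gapped A s ->
  fits p l q ->
  (forall E, (size E < size s)%N -> thin_bound E /\ wide_bound E) ->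
  [\/ exists i E, dominated s l q T i E,
      exists i v j E, next_dominated s l q T i v j E |
      T <= 1203/1000 * cost p s].
Proof.
move=> adm; have [n] := ubnP (size s).
elim: n s l q T => // n IH s l q T sn r gs hf bd.
have [q0 ql e _] := run_facts r.
have [dom|] := gapped_run r gs; first by constructor 1.
move=> [u [v [Tu [Tv [[ps uv vu] [gv gu] [suv svu] [ru rv] TE]]]]].
have sE : ar s = ar u + ar v by rewrite (perm_block_area _ ps) block_area_cat.
have [_ _ _ un0] := run_facts ru; have [_ _ _ vn0] := run_facts rv.
have su : (0 < size u)%N by rewrite lt0n size_eq0.
have sz : size s = (size u + size v)%N by rewrite (perm_size ps) size_cat.
have sv : (size v < size s)%N by rewrite sz -[X in (X < _)%N]add0n ltn_add2r.
have e' : l * q = ar u + ar v by rewrite e.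
have fu := fits_child q0 ql e' uv vu hf.
have fv : fits p (Num.max (ar v / q) q) (Num.min (ar v / q) q).
  by apply: (@fits_child _ p l q _ (ar u)) => //; rewrite addrC.
have cE : cost p s = cost p u + cost p v by rewrite (perm_cost A p ps) cost_cat.
have [] := IH v _ _ _ (leq_trans sv sn) rv gv fv.
- by move=> E Ev; apply: bd; exact: ltn_trans Ev sv.
- move=> [i [E dv]]; have [En0 pv Ei _] := dv.
  have sE' : (size E < size s)%N.
    by apply: leq_ltn_trans sv; rewrite (perm_size pv) /=.
  have hi : all (fun k => A i <= A k) u.
    case: svu => _ + _; apply; rewrite (perm_gap A _ pv); exact: gap_cons.
  have [su2|su1] := ltnP 1 (size u).
    constructor 3; have [tE wE] := bd _ sE'; rewrite TE cE.
    exact: (pair_over_dominated A_gt0 adm hf q0 ql e' uv vu gu su2 hi ru dv tE wE).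
  have [_ [k uE]] := run_single ru su1.
  have ukE : ar u = A k by rewrite uE block_area_seq1.
  constructor 2; exists k, v, i, E; split.
  + by rewrite uE in ps.
  + by rewrite -ukE.
  + by rewrite -uE.
  + by exists Tv => //; rewrite TE (run_child_single ru su1) ukE.
- move=> [i [w [j [E nv]]]]; constructor 3; rewrite TE cE.
  have [pv _ _ [Tw [En0 pw _ _] _]] := nv.
  have sE' : (size E < size s)%N.
    apply: leq_ltn_trans sv; rewrite (perm_size pv) /= (perm_size pw) /=.
    by rewrite -addn2 leq_addr.
  have [tE wE] := bd _ sE'.
  exact: (over_next_dominated A_gt0 adm hf q0 ql e' uv vu gu svu ru nv tE wE).
- move=> Tvle; constructor 3; rewrite TE cE.
  by have := nogap_le A_gt0 adm ru gu fu; move: Tvle; clear; lra.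
Qed.

Lemma sqrt_perim2 q a : 0 < q -> 0 < a -> 1203/500 * sqrt a <= a / q + 2 * q.
Proof.
move=> q0 a0; have [r [r0 _ -> ->]] := root_scale q0 a0.
have : 0 <= q * (r - 1203/1000) ^+ 2 by rewrite mulr_ge0 ?sqr_ge0 ?ltW.
have : 0 <= q * r by rewrite mulr_ge0 ?ltW.
by rewrite sqrrB -mulr_natl; move: q0; clear; lra.
Qed.

(** In a long rectangle cut in balance, the gap-free half has error [6/5 * q] by [nogap_thin_bound];
    the gain from splitting the root cancels exactly that and leaves the [2 * q] of the other
    half. *)
Lemma thin_bound_step s :
  (forall E, (size E < size s)%N -> thin_bound E /\ wide_bound E) -> thin_bound s.
Proof.
move=> bd l q T r; have [q0 ql e n0] := run_facts r.
have s0 := block_area_gt0 A_gt0 n0.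
have [gs|ng] := pselect (gapped A s); last first.
  by have := nogap_thin_bound A_gt0 r ng; move: q0; clear; lra.
have domcase i E : dominated s l q T i E ->
    T <= 1203/1000 * cost0 s + l + 2 * q - 1203/500 * sqrt (ar s).
  move=> dom; apply: (dominated_thin A_gt0 q0 e dom).
  by have [_ ps _ _] := dom; apply: (bd E _).1; rewrite (perm_size ps).
have /orP[l3|l3] := le_total l (3 * q).
  have [] := gapped_trichotomy admissible_sqrt r gs (or_introl l3) bd.
  - by move=> [i [E]]; exact: domcase.
  - move=> [i [v [j [E nd]]]].
    have [sE vE E0 [ji Ej] [iv vi]] := next_dominated_facts A_gt0 nd.
    have [ps _ _ [Tv dv ->]] := nd; have [_ pv _ _] := dv.
    have sv : (size E < size s)%N.
      by rewrite (perm_size ps) /= (perm_size pv) /= -addn2 -addn1 leq_add2l.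
    have i0 := A_gt0 i; have v0 : 0 < ar v by rewrite vE addr_gt0.
    have S0 : 0 < Num.min (ar v / q) q by rewrite lt_min divr_gt0.
    have := dominated_thin A_gt0 S0 (maxMmin _ q0) dv (bd _ sv).1.
    rewrite (perm_cost A _ ps) cost_cons sE.
    have lE : l = A i / q + ar v / q by rewrite -mulrDl -sE -e mulfK // gt_eqF.
    have hm : Num.min (ar v / q) q <= sqrt (ar v).
      have /orP[h|h] := le_total (ar v) (q * q); first by rewrite ge_min div_le_sqrt.
      by rewrite ge_min; apply/orP; right; exact: le_sqrt_scale.
    (* The block [v] has at most two thirds of the area, and [82/100 > sqrt (2/3)]. *)
    have hv : sqrt (ar v) <= 82/100 * sqrt (A i + ar v).
      have s1 := sqrtr_ge0 (A i + ar v); apply: ge_of_sqr; first by move: s1; clear; lra.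
      rewrite exprMn (sqr_sqrtr (ltW v0)) (sqr_sqrtr (ltW (addr_gt0 i0 v0))).
      by move: vi v0; clear; lra.
    have := sqrt_add_ge i0 v0 iv vi; have := addr_max_min (ar v / q) q.
    have := sqrtr_ge0 (A i + ar v).
    by move: hm hv; rewrite lE; clear; lra.
  - have := sqrt_perim2 q0 s0; have -> : ar s / q = l by rewrite -e mulfK ?gt_eqF.
    by rewrite /cost; clear; lra.
have [[i [E]]|] := gapped_run r gs; first exact: domcase.
move=> [u [v [Tu [Tv [[ps uv vu] [gv gu] [suv svu] [ru rv] TE]]]]].
have sE : ar s = ar u + ar v by rewrite (perm_block_area _ ps) block_area_cat.
have [_ _ _ un0] := run_facts ru; have [_ _ _ vn0] := run_facts rv.
have u0 := block_area_gt0 A_gt0 un0; have v0 := block_area_gt0 A_gt0 vn0.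
have sv : (size v < size s)%N.
  rewrite (perm_size ps) size_cat -[X in (X < _)%N]add0n ltn_add2r.
  by rewrite lt0n size_eq0.
have q1 := long_side q0 (etrans e sE) uv vu l3.
have q2 : q * q <= ar v by apply: (long_side q0 _ vu uv l3); rewrite e sE addrC.
have qu : q <= ar u / q by rewrite ler_pdivlMr.
have qv : q <= ar v / q by rewrite ler_pdivlMr.
have := (bd v sv).1 _ _ _ rv; have := nogap_thin_bound A_gt0 ru gu.
rewrite (max_l qu) (min_r qu) (max_l qv) (min_r qv) (perm_cost A _ ps) cost_cat sE TE.
have lE : l = ar u / q + ar v / q by rewrite -mulrDl -sE -e mulfK // gt_eqF.
have h3 : 3 * (q * q) <= ar u + ar v by rewrite -sE -e mulrA ler_pM2r.
have := sqrt_split_gain q0 u0 v0 uv vu h3.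
by rewrite lE; clear; lra.
Qed.

Lemma wide_bound_step s :
  (forall E, (size E < size s)%N -> thin_bound E /\ wide_bound E) -> wide_bound s.
Proof.
move=> bd p l q T adm tr r; have [q0 ql e n0] := run_facts r.
have s0 := block_area_gt0 A_gt0 n0.
have [gs|ng] := pselect (gapped A s); last first.
  by have := nogap_le A_gt0 adm r ng (or_intror tr); move: q0; clear; lra.
have domcase i E : dominated s l q T i E -> T <= 1203/1000 * cost p s + 3/5 * q.
  move=> dom; have [_ ps _ _] := dom.
  have [tE wE] : thin_bound E /\ wide_bound E by apply: bd; rewrite (perm_size ps).
  exact: (dominated_wide A_gt0 q0 ql e dom tE adm tr wE).
have /orP[l3|l3] := le_total l (3 * q).
  have [] := gapped_trichotomy adm r gs (or_introl l3) bd.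
  - by move=> [i [E]]; exact: domcase.
  - move=> [i [v [j [E nd]]]].
    have [sE vE E0 [ji Ej] [iv vi]] := next_dominated_facts A_gt0 nd.
    have [ps _ _ [Tv dv ->]] := nd; have [_ pv _ _] := dv.
    have sv : (size E < size s)%N.
      by rewrite (perm_size ps) /= (perm_size pv) /= -addn2 -addn1 leq_add2l.
    have [tE wE] := bd _ sv.
    have i0 := A_gt0 i; have j0 := A_gt0 j; have v0 : 0 < ar v by rewrite vE addr_gt0.
    have S0 : 0 < Num.min (ar v / q) q by rewrite lt_min divr_gt0.
    have hs : ar s <= 3 * (q * q) by rewrite -e mulrA ler_pM2r.
    have hs' : q * q <= ar s by rewrite -e ler_pM2r.
    rewrite (perm_cost A _ ps) cost_cons; have adi := adm _ i0.
    have /orP[h|h] := le_total (q * q) (ar v).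
      have qv : q <= ar v / q by rewrite ler_pdivlMr.
      have SE : Num.min (ar v / q) q = q by rewrite min_r.
      have trS : truncated p (Num.min (ar v / q) q) by rewrite SE.
      have := dominated_wide A_gt0 S0 (min_le_max _ _) (maxMmin _ q0) dv tE adm trS wE.
      have h1 : q * q <= 3 * A i by move: hs' vi; rewrite sE; clear; lra.
      have h2 : A i <= 3 * (q * q) by move: hs v0; rewrite sE; clear; lra.
      have := scaled_single_le q0 i0 h1 h2.
      by rewrite SE; move: adi; clear; lra.
    have vq : ar v / q <= q by rewrite ler_pdivrMr.
    have := dominated_thin A_gt0 S0 (maxMmin _ q0) dv tE.
    rewrite (max_r vq) (min_l vq).
    have h1 : 2 * ar v <= 3 * A i by rewrite vE; move: ji Ej; clear; lra.
    have h2 : q * q <= A i + ar v by rewrite -sE.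
    have h3 : A i <= 2 * (q * q) by move: iv h; clear; lra.
    have := scaled_single_dominant_wide q0 i0 v0 iv h1 h2 h3 h.
    have := div_le_sqrt q0 v0 h; have := cost0_le A_gt0 v adm.
    by have := sqrtr_ge0 (ar v); move: adi; clear; lra.
  - by move: q0; clear; lra.
have [[i [E]]|] := gapped_run r gs; first exact: domcase.
move=> [u [v [Tu [Tv [[ps uv vu] [gv gu] [suv svu] [ru rv] TE]]]]].
have sE : ar s = ar u + ar v by rewrite (perm_block_area _ ps) block_area_cat.
have e' : l * q = ar u + ar v by rewrite e.
have [_ _ _ un0] := run_facts ru.
have sv : (size v < size s)%N.
  rewrite (perm_size ps) size_cat -[X in (X < _)%N]add0n ltn_add2r.
  by rewrite lt0n size_eq0.
have q2 : q * q <= ar v by apply: (long_side q0 _ vu uv l3); rewrite e sE addrC.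
have qv : q <= ar v / q by rewrite ler_pdivlMr.
have fu := fits_child q0 ql e' uv vu (or_intror tr).
have := nogap_le A_gt0 adm ru gu fu.
rewrite (max_l qv) (min_r qv) in rv.
have := (bd v sv).2 _ _ _ _ adm tr rv.
by rewrite (perm_cost A _ ps) cost_cat TE; clear; lra.
Qed.

Lemma thin_wide_bound s : thin_bound s /\ wide_bound s.
Proof.
have [n] := ubnP (size s); elim: n s => // n IH s sn.
have bd E : (size E < size s)%N -> thin_bound E /\ wide_bound E.
  by move=> Es; apply: IH; exact: leq_trans Es sn.
by split; [exact: thin_bound_step | exact: wide_bound_step].
Qed.

End Induction.

(** * Lower bounds for arbitrary partitions *)

Section PerimLb.
Variable R : realType.
Implicit Types q a z w x : R.
Local Notation sqrt := Num.sqrt.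

(* A rectangle of area [a] which has a side at most [q] has perimeter at least
   [perim_lb q a]. *)
Definition perim_lb q a : R := if a <= q * q then 2 * sqrt a else a / q + q.

Lemma perim_lb_admissible q : 0 < q -> admissible (perim_lb q).
Proof.
move=> q0 a a0; rewrite /perim_lb; case: ifP => // _; exact: sqrt_perim.
Qed.

Lemma perim_lb_truncated q : 0 < q -> truncated (perim_lb q) q.
Proof.
move=> q0 x; rewrite le_eqVlt => /orP[/eqP<-|qx]; rewrite /perim_lb.
  by rewrite lexx -expr2 sqrtr_sqr ger0_norm ?ltW // mulrDl mul1r.
by rewrite ler_pM2r // leNgt qx /= mulfK // gt_eqF.
Qed.

Lemma perim_lb_le1 q z w : 0 < q -> 0 < z -> 0 < w -> z <= q ->
  perim_lb q (z * w) <= z + w.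
Proof.
move=> q0 z0 w0 zq; rewrite /perim_lb; case: ifP => [_|/negbT].
  have := sqrt_perim z0 (mulr_gt0 z0 w0); rewrite [z * w]mulrC mulfK ?gt_eqF //.
  by rewrite addrC.
rewrite -ltNge => h; rewrite -subr_ge0.
have -> : z + w - (z * w / q + q) = (q - z) * (w - q) / q by field; rewrite gt_eqF.
rewrite divr_ge0 ?(ltW q0) //; apply: mulr_ge0; rewrite subr_ge0 //.
have : q * q < q * w by apply: lt_le_trans h _; rewrite ler_pM2r.
by rewrite ltr_pM2l // => /ltW.
Qed.

Lemma perim_lb_le q z w : 0 < q -> 0 < z -> 0 < w -> z <= q \/ w <= q ->
  perim_lb q (z * w) <= z + w.
Proof.
move=> q0 z0 w0 [zq|wq]; first exact: perim_lb_le1.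
by rewrite mulrC addrC; exact: perim_lb_le1.
Qed.
End PerimLb.

(** * Comparison with a competing partition at the root *)

Section Root.
Variables (R : realType) (I : eqType) (A : I -> R).
Hypothesis A_gt0 : forall i, 0 < A i.
Variables (X0 X1 Y0 Y1 : I -> R).
Implicit Types (s E u v w : seq I) (a b d e l q T x : R) (p : R -> R).
Local Notation ar := (block_area A).
Local Notation sqrt := Num.sqrt.
Local Notation run := (run A).
Local Notation cost := (cost A).
Local Notation cost0 := (cost (fun a => 2 * sqrt a)).

(** Coordinates relative to a corner, with the [X] axis along the long side [l]; disjointness of
    interiors is separation along one of the axes. *)
Definition packing l q : Prop :=
  [/\ forall i, [/\ 0 <= X0 i, X0 i < X1 i & X1 i <= l],
      forall i, [/\ 0 <= Y0 i, Y0 i < Y1 i & Y1 i <= q],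
      forall i, (X1 i - X0 i) * (Y1 i - Y0 i) = A i &
      forall i j, i != j -> (X1 i <= X0 j \/ X1 j <= X0 i) \/ (Y1 i <= Y0 j \/ Y1 j <= Y0 i)].

Definition total s : R := \sum_(i <- s) ((X1 i - X0 i) + (Y1 i - Y0 i)).

Lemma total_cons i s : total (i :: s) = (X1 i - X0 i) + (Y1 i - Y0 i) + total s.
Proof. by rewrite /total big_cons. Qed.

Lemma packing_dims l q i : packing l q ->
  [/\ 0 < X1 i - X0 i, X1 i - X0 i <= l, 0 < Y1 i - Y0 i, Y1 i - Y0 i <= q &
      (X1 i - X0 i) * (Y1 i - Y0 i) = A i].
Proof.
move=> [hx hy hA _]; have [x0 x01 x1] := hx i; have [y0 y01 y1] := hy i.
by split=> //; lra.
Qed.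

Lemma packing_sides l q i : packing l q ->
  [/\ 0 < l, 0 < q, A i / q <= X1 i - X0 i & A i / l <= Y1 i - Y0 i].
Proof.
move=> pk; have [w0 wl d0 dq <-] := packing_dims i pk.
have l0 : 0 < l by apply: lt_le_trans wl.
have q0 : 0 < q by apply: lt_le_trans dq.
by split=> //; rewrite ler_pdivrMr ?ler_pM2l // mulrC ler_pM2l.
Qed.

Lemma cost_le_total l q x s : packing l q -> 0 < x ->
  (forall i, i \in s -> X1 i - X0 i <= x \/ Y1 i - Y0 i <= x) ->
  cost (perim_lb x) s <= total s.
Proof.
move=> pk x0 h; rewrite /cost /total big_seq [leRHS]big_seq.
apply: ler_sum => i /h; have [w0 _ d0 _ <-] := packing_dims i pk.
exact: perim_lb_le.
Qed.

(** The rectangle of [i] is at least [A i / q] wide and [A i / l] high, so a rectangle beside it has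
    width at most [e / q], and one above or below it has height at most [e / l <= e / q]. *)
Lemma rest_side l q e i k : packing l q -> A i + e = l * q -> q <= l -> 0 <= e -> k != i ->
  X1 k - X0 k <= e / q \/ Y1 k - Y0 k <= e / q.
Proof.
move=> pk Ae ql e0 ki; have [hx hy _ sep] := pk.
have [x0 x01 x1] := hx i; have [y0 y01 y1] := hy i.
have [kx0 kx01 kx1] := hx k; have [ky0 ky01 ky1] := hy k.
have [l0 q0 wi di] := packing_sides i pk.
have lE : l = A i / q + e / q by rewrite -mulrDl Ae mulfK // gt_eqF.
have qE : q = A i / l + e / l by rewrite -mulrDl Ae [l * q]mulrC mulfK // gt_eqF.
have elq : e / l <= e / q by rewrite ler_wpM2l // lef_pV2.
have [hX|hY] := sep k i ki.
  by left; case: hX => h; move: lE wi h x0 x1 kx0 kx1; clear; lra.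
by right; case: hY => h; move: qE elq di h y0 y1 ky0 ky1; clear; lra.
Qed.

(** The bound [e / q] holds if [k] lies beside both large rectangles, whose widths are at least
    [A i / q] and [A j / q]. Otherwise [k] shares the height [q] with at least one of them. *)
Lemma rest_side2 l q e i j k : packing l q -> A i + (A j + e) = l * q -> q <= l -> 0 <= e ->
  A j <= A i -> k != i -> k != j -> (X1 i <= X0 j \/ X1 j <= X0 i) ->
  X1 k - X0 k <= e / q \/ Y1 k - Y0 k <= q * (e / (A j + e)).
Proof.
move=> pk Ae ql e0 ji ki kj sij; have [hx hy _ sep] := pk.
have [x0 x01 x1] := hx i; have [y0 y01 y1] := hy i.
have [jx0 jx01 jx1] := hx j; have [jy0 jy01 jy1] := hy j.
have [kx0 kx01 kx1] := hx k; have [ky0 ky01 ky1] := hy k.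
have [l0 q0 wi di] := packing_sides i pk.
have [_ _ wj dj] := packing_sides j pk.
have lE : l = A i / q + (A j / q + e / q) by rewrite -!mulrDl Ae mulfK // gt_eqF.
have wij : (X1 i - X0 i) + (X1 j - X0 j) <= l.
  by case: sij => h; move: h x0 jx1 jx0 x1; clear; lra.
have i0 := A_gt0 i; have j0 := A_gt0 j.
have V0 : 0 < A j + e by rewrite ltr_wpDr.
(* Beside one large rectangle, [k] is above or below the other one, [m]. The width of [m] is at most
   [(A m + e) / q], which forces its height up to [q * (A m / (A m + e))]; the remaining height is
   largest for the smaller area [A j]. *)
have mixed m : A j <= A m -> X1 m - X0 m <= (A m + e) / q ->
    (Y1 k - Y0 k) + (Y1 m - Y0 m) <= q -> Y1 k - Y0 k <= q * (e / (A j + e)).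
  move=> jm wm dkm; have m0 := A_gt0 m; have me0 : 0 < A m + e by rewrite ltr_wpDr.
  have [w0 _ d0 _ mE] := packing_dims m pk.
  have h1 : q * (A m / (A m + e)) <= Y1 m - Y0 m.
    have -> : q * (A m / (A m + e)) = A m / ((A m + e) / q) by field; rewrite !gt_eqF.
    by rewrite ler_pdivrMr ?divr_gt0 // -{1}mE mulrC ler_pM2l.
  have h2 : q * (e / (A m + e)) <= q * (e / (A j + e)).
    rewrite ler_pM2l //; apply: ler_wpM2l => //.
    by rewrite lef_pV2 ?posrE // lerD2r.
  have h3 : q = q * (A m / (A m + e)) + q * (e / (A m + e)) by field; rewrite gt_eqF.
  by move: h1 h2 h3 dkm; clear; lra.
have dsep m : (Y1 k <= Y0 m \/ Y1 m <= Y0 k) -> (Y1 k - Y0 k) + (Y1 m - Y0 m) <= q.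
  have [my0 _ my1] := hy m.
  by case=> h; move: h my0 my1 ky0 ky1; clear; lra.
have [hXi|/dsep hYi] := sep k i ki; have [hXj|/dsep hYj] := sep k j kj.
- left; move: wi wj lE x0 x1 jx0 jx1 kx0 kx1 x01 jx01 kx01.
  by case: sij => h; case: hXi => h'; case: hXj => h''; move: h h' h''; clear; lra.
- right; apply: (mixed j) => //.
  by rewrite mulrDl; move: wi wij lE; clear; lra.
- right; apply: (mixed i) => //.
  by rewrite mulrDl; move: wj wij lE; clear; lra.
(* Above or below both: the two large areas fit into height [q] minus that of [k], over a total
   width of at most [l], so [l] times the height of [k] is at most [e]. *)
- right; have [w0 _ d0 _ iE] := packing_dims i pk; have [w0' _ d0' _ jE] := packing_dims j pk.
  have d : 0 <= q - (Y1 k - Y0 k) by move: ky0 ky1; clear - A_gt0 X0 X1 Y0 Y1; lra.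
  have hi : A i <= (X1 i - X0 i) * (q - (Y1 k - Y0 k)).
    by rewrite -iE ler_pM2l //; move: hYi; clear; lra.
  have hj : A j <= (X1 j - X0 j) * (q - (Y1 k - Y0 k)).
    by rewrite -jE ler_pM2l //; move: hYj; clear; lra.
  have hij := ler_wpM2r d wij.
  have h1 : l * (Y1 k - Y0 k) <= e.
    by move: hi hj hij Ae; clear; lra.
  have h2 : e <= l * (q * (e / (A j + e))).
    have -> : l * (q * (e / (A j + e))) = e * ((l * q) / (A j + e)).
      by field; rewrite gt_eqF.
    by apply: ler_peMr => //; rewrite ler_pdivlMr // mul1r -Ae lerDr ltW.
  by rewrite -(ler_pM2l l0); apply: le_trans h2.
Qed.

Lemma stacked_le l q i j : packing l q -> (Y1 i <= Y0 j \/ Y1 j <= Y0 i) ->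
  q <= sqrt (A i) + sqrt (A j) ->
  (sqrt (A i) + sqrt (A j)) ^+ 2 / q + q <=
    (X1 i - X0 i) + (Y1 i - Y0 i) + ((X1 j - X0 j) + (Y1 j - Y0 j)).
Proof.
move=> pk hY qs; have [_ hy _ _] := pk.
have [y0 y01 y1] := hy i; have [jy0 jy01 jy1] := hy j.
have [w0 _ d0 _ iE] := packing_dims i pk; have [w0' _ d0' _ jE] := packing_dims j pk.
have yz : (Y1 i - Y0 i) + (Y1 j - Y0 j) <= q.
  by case: hY => h; move: h y0 jy1 jy0 y1; clear - A_gt0 X0 X1 Y0 Y1; lra.
have := titu d0 d0' (A_gt0 i) (A_gt0 j) yz qs.
by rewrite -{2}iE -{2}jE !mulfK ?gt_eqF.
Qed.

(** The error of [E] is [3/5] of the short side of its strip, hence at most [3/10 * (A j / q)],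
    which [j] can pay by [scaled_threetenths]. If [A j >= q * q], its perimeter is at least three
    times that side, and [3 * 203/1000 > 3/5]. *)
Lemma dominant_piece q j E TE : 0 < q -> E != [::] -> 2 * ar E < A j ->
  q * q <= A j + ar E ->
  run E (Num.max (ar E / q) q) (Num.min (ar E / q) q) TE ->
  A j / q + q + TE <=
    1203/1000 * (perim_lb q (A j) + cost (perim_lb (Num.min (ar E / q) q)) E).
Proof.
move=> q0 En0 Ej qs rE; have E0 := block_area_gt0 A_gt0 En0; have j0 := A_gt0 j.
have x0 : 0 < Num.min (ar E / q) q by rewrite lt_min divr_gt0.
have := (thin_wide_bound A_gt0 E).2 _ _ _ _ (perim_lb_admissible x0) (perim_lb_truncated x0) rE.
have hx : Num.min (ar E / q) q <= ar E / q by rewrite ge_min lexx.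
have hq : Num.min (ar E / q) q <= q by rewrite ge_min lexx orbT.
have jq : 2 * (ar E / q) <= A j / q by rewrite mulrA ler_pM2r ?invr_gt0 // ltW.
have /orP[h|h] := le_total (q * q) (A j).
  rewrite (wide_single q0 h (perim_lb_truncated q0)).
  by move: hx hq jq q0; clear - A_gt0 X0 X1 Y0 Y1; lra.
have h3 : 2 * (q * q) <= 3 * A j by move: qs Ej; clear - A_gt0 X0 X1 Y0 Y1; lra.
have := scaled_threetenths q0 j0 h3 h; have := perim_lb_admissible q0 j0.
by move: hx jq; clear - A_gt0 X0 X1 Y0 Y1; lra.
Qed.

Lemma root_dominated l q T s i E : packing l q -> uniq s -> 0 < q -> q <= l ->
  l * q = ar s -> dominated A s l q T i E -> T <= 1203/1000 * total s.
Proof.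
move=> pk us q0 ql e dom; have sE := dominated_area dom.
have [En0 ps Ei [TE rE ->]] := dom; have E0 := block_area_gt0 A_gt0 En0.
have x0 : 0 < Num.min (ar E / q) q by rewrite lt_min divr_gt0.
have qs : q * q <= A i + ar E by rewrite -sE -e ler_pM2r.
apply: le_trans (dominant_piece q0 En0 Ei qs rE) _.
rewrite ler_pM2l; last by clear - A_gt0 X0 X1 Y0 Y1; lra.
rewrite /total (perm_big _ ps) big_cons -/(total E); apply: lerD.
  have [w0 _ d0 dq iE] := packing_dims i pk; rewrite -iE.
  by apply: perim_lb_le => //; right.
have iE : i \notin E by have := perm_uniq ps; rewrite us /= => /esym /andP[].
apply: (cost_le_total pk x0) => k kE.
have ki : k != i by apply: contraNneq iE => <-.
have [_ _ _ dq _] := packing_dims k pk.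
have Ae : A i + ar E = l * q by rewrite e.
rewrite !le_min dq andbT; have [h|h] := rest_side pk Ae ql (ltW E0) ki; last by right.
have /orP[h'|h'] := le_total (ar E / q) q.
  by left; rewrite h (le_trans h h').
by right; apply: le_trans dq h'.
Qed.

Lemma root_next_dominated l q T s i v j E : packing l q -> uniq s -> 0 < q -> q <= l ->
  l * q = ar s -> next_dominated A s l q T i v j E -> T <= 1203/1000 * total s.
Proof.
move=> pk us q0 ql e nd.
have [sE vE E0 [ji Ej] [iv vi]] := next_dominated_facts A_gt0 nd.
have [ps _ _ [Tv [En0 pv _ [TE rE ->]] ->]] := nd.
have i0 := A_gt0 i; have j0 := A_gt0 j; have v0 : 0 < ar v by rewrite vE addr_gt0.
have pij : perm_eq s [:: i, j & E] by apply: perm_trans ps _; rewrite perm_cons.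
have Ae : A i + (A j + ar E) = l * q by rewrite e sE vE.
have qs : q * q <= A i + ar v by rewrite -sE -e ler_pM2r.
have := perm_uniq pij; rewrite us /= inE negb_or => /esym /and3P[/andP[ij iE] jE _].
have tE : total s = (X1 i - X0 i) + (Y1 i - Y0 i) + ((X1 j - X0 j) + (Y1 j - Y0 j)) + total E.
  have -> : total s = total [:: i, j & E] by apply: perm_big.
  by rewrite !total_cons addrA.
have [wi0 _ di0 diq iA] := packing_dims i pk; have [wj0 _ dj0 djq jA] := packing_dims j pk.
have pi : perim_lb q (A i) <= (X1 i - X0 i) + (Y1 i - Y0 i).
  by rewrite -iA; apply: perim_lb_le => //; right.
have pj : perim_lb q (A j) <= (X1 j - X0 j) + (Y1 j - Y0 j).
  by rewrite -jA; apply: perim_lb_le => //; right.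
have c0 : cost0 E <= total E.
  apply: le_trans (cost0_le A_gt0 E (perim_lb_admissible q0)) _.
  by apply: (cost_le_total pk q0) => k _; right; have [] := packing_dims k pk.
have kE k : k \in E -> k != i /\ k != j.
  by move=> kin; split; [apply: contraNneq iE => <- | apply: contraNneq jE => <-].
have qn0 : q != 0 by rewrite gt_eqF.
have sq3 : A i + 3 * A j <= (sqrt (A i) + sqrt (A j)) ^+ 2.
  rewrite sqrrD !sqr_sqrtr ?(ltW i0) ?(ltW j0) // -mulr_natl.
  have : A j <= sqrt (A i) * sqrt (A j).
    rewrite -{1}(sqr_sqrtr (ltW j0)) expr2 ler_pM2r ?sqrtr_gt0 //.
    exact: ler_wsqrtr.
  by clear - A_gt0 X0 X1 Y0 Y1; lra.
(* The range in which a stack of [i] and [j] is cheapest at full height [q]; it follows from [q * q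
   <= A i + A j + ar E <= A i + 3 * A j]. *)
have qst : q <= sqrt (A i) + sqrt (A j).
  apply: ge_of_sqr; first by rewrite addr_ge0 ?sqrtr_ge0.
  apply: le_trans sq3; move: qs; rewrite -expr2 vE; move: Ej E0 j0; clear - A_gt0 X0 X1 Y0 Y1; lra.
have [sij|yij] : (X1 i <= X0 j \/ X1 j <= X0 i) \/ (Y1 i <= Y0 j \/ Y1 j <= Y0 i).
- by have [_ _ _] := pk; exact.
- have side k := fun kin => let: conj ki kj := kE k kin in
    rest_side2 pk Ae ql (ltW E0) ji ki kj sij.
  have jV : A j <= ar v by rewrite vE lerDl ltW.
  have Vj : 2 * ar v <= 3 * A j by rewrite vE; move: Ej; clear - A_gt0 X0 X1 Y0 Y1; lra.
  rewrite tE; have /orP[h|h] := le_total (ar v) (q * q).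
    have vq : ar v / q <= q by rewrite ler_pdivrMr.
    move: rE; rewrite (min_l vq).
    have -> : ar E / (ar v / q) = q * (ar E / ar v) by field; rewrite !gt_eqF.
    (* The height [q * (ar E / ar v)] of the strip of [E] is missing from the perimeter of [j]; this
       saving exceeds the error of [E], which is [3/5] of the same length. *)
    have -> : A j / (ar v / q) = q - q * (ar E / ar v).
      by rewrite vE; field; rewrite -vE !gt_eqF.
    have xs : q * (ar E / ar v) <= ar v / q.
      rewrite mulrA ler_pdivrMr // mulrAC ler_pdivlMr //.
      have : q * q * ar E <= (3 * ar v) * ar E.
        by rewrite ler_pM2r //; move: qs iv; clear - A_gt0 X0 X1 Y0 Y1; lra.
      have : (3 * ar E) * ar v <= ar v * ar v.
        by rewrite ler_pM2r // vE; move: Ej; clear - A_gt0 X0 X1 Y0 Y1; lra.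
      by clear - A_gt0 X0 X1 Y0 Y1; lra.
    rewrite (max_r xs) (min_l xs) => rE.
    have x0 : 0 < q * (ar E / ar v) by rewrite mulr_gt0 // divr_gt0.
    have := (thin_wide_bound A_gt0 E).2 _ _ _ _ (perim_lb_admissible x0)
      (perim_lb_truncated x0) rE.
    have cE : cost (perim_lb (q * (ar E / ar v))) E <= total E.
      apply: (cost_le_total pk x0) => k /side; rewrite -vE => -[hk|hk]; last by right.
      left; apply: le_trans hk _; rewrite mulrCA ler_pM2l //.
      by rewrite ler_pdivlMr // mulrC ler_pdivrMr.
    have ai := perim_lb_admissible q0 i0; have aj := perim_lb_admissible q0 j0.
    have /orP[hi|hi] := le_total (A i) (q * q).
      have := scaled_sep q0 i0 j0 v0 jV Vj ji iv qs h hi.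
      by move: cE x0 pi pj ai aj; clear - A_gt0 X0 X1 Y0 Y1; lra.
    have hv : q * q <= 2 * ar v by apply: le_trans iv.
    have qi : q <= A i / q by rewrite ler_pdivlMr.
    have := scaled_sep_wide q0 j0 v0 jV Vj hv h.
    move: pi; rewrite (wide_single q0 hi (perim_lb_truncated q0)).
    by move: cE x0 pj aj qi q0; clear - A_gt0 X0 X1 Y0 Y1; lra.
  have qv : q <= ar v / q by rewrite ler_pdivlMr.
  move: rE; rewrite (min_r qv) => rE.
  have qj : q * q <= A j + ar E by rewrite -vE.
  have := dominant_piece q0 En0 Ej qj rE.
  have hi3 : 2 * (q * q) <= 3 * A i by move: h Vj ji; clear - A_gt0 X0 X1 Y0 Y1; lra.
  have := wide_piece23 (perim_lb_admissible q0) (perim_lb_truncated q0) q0 i0 hi3.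
  have x0 : 0 < Num.min (ar E / q) q by rewrite lt_min divr_gt0.
  have cE : cost (perim_lb (Num.min (ar E / q) q)) E <= total E.
    apply: (cost_le_total pk x0) => k /side; rewrite -vE.
    have [_ _ _ dq _] := packing_dims k pk; rewrite !le_min dq andbT => -[hk|hk].
      have /orP[h'|h'] := le_total (ar E / q) q; first by left; rewrite hk (le_trans hk h').
      by right; apply: le_trans dq h'.
    right; apply: le_trans hk _; rewrite mulrCA ler_pM2l //.
    by rewrite ler_pdivrMr // mulrC ler_pdivlMr.
  by move: cE pi pj q0; clear - A_gt0 X0 X1 Y0 Y1; lra.
have st := stacked_le pk yij qst.
rewrite tE; have /orP[h|h] := le_total (ar v) (q * q).
  have vq : ar v / q <= q by rewrite ler_pdivrMr.
  move: rE; rewrite (min_l vq).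
  have -> : ar E / (ar v / q) = q * (ar E / ar v) by field; rewrite !gt_eqF.
  have -> : A j / (ar v / q) = q - q * (ar E / ar v).
    by rewrite vE; field; rewrite -vE !gt_eqF.
  have xs : q * (ar E / ar v) <= ar v / q.
    rewrite mulrA ler_pdivrMr // mulrAC ler_pdivlMr //.
    have : q * q * ar E <= (3 * ar v) * ar E.
      by rewrite ler_pM2r //; move: qs iv; clear - A_gt0 X0 X1 Y0 Y1; lra.
    have : (3 * ar E) * ar v <= ar v * ar v.
      by rewrite ler_pM2r // vE; move: Ej; clear - A_gt0 X0 X1 Y0 Y1; lra.
    by clear - A_gt0 X0 X1 Y0 Y1; lra.
  rewrite (max_r xs) (min_l xs) => rE.
  have := (thin_wide_bound A_gt0 E).1 _ _ _ rE.
  move: qs h iv; rewrite vE => qs h iv.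
  have := scaled_stack q0 i0 j0 E0 (ltW Ej) ji iv qs h.
  by move: c0 st; clear - A_gt0 X0 X1 Y0 Y1; lra.
have qv : q <= ar v / q by rewrite ler_pdivlMr.
move: rE; rewrite (min_r qv) => rE.
have hTE : TE <= 1203/1000 * total E + q.
  have /orP[he|he] := le_total (ar E) (q * q).
    have eq : ar E / q <= q by rewrite ler_pdivrMr.
    have := (thin_wide_bound A_gt0 E).1 _ _ _ rE; rewrite (max_r eq) (min_l eq).
    have := div_le_sqrt q0 E0 he; have := sqrtr_ge0 (ar E).
    by move: c0; clear - A_gt0 X0 X1 Y0 Y1; lra.
  have eq : q <= ar E / q by rewrite ler_pdivlMr.
  move: rE; rewrite (max_l eq) (min_r eq) => rE.
  have := (thin_wide_bound A_gt0 E).2 _ _ _ _ (perim_lb_admissible q0)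
      (perim_lb_truncated q0) rE.
  have : cost (perim_lb q) E <= total E.
    by apply: (cost_le_total pk q0) => k _; right; have [] := packing_dims k pk.
  by move: q0; clear - A_gt0 X0 X1 Y0 Y1; lra.
have j3 : 2 / 3 * q <= A j / q.
  by rewrite ler_pdivlMr // -mulrA; move: h; rewrite vE; move: Ej; clear - A_gt0 X0 X1 Y0 Y1; lra.
have ij' : A j / q <= A i / q by rewrite ler_pM2r ?invr_gt0.
have : (A i + 3 * A j) / q <= (sqrt (A i) + sqrt (A j)) ^+ 2 / q.
  by rewrite ler_pM2r ?invr_gt0.
rewrite mulrDl -mulrA => hsq.
by move: q0 hTE j3 ij' hsq st; clear - A_gt0 X0 X1 Y0 Y1; lra.
Qed.

Lemma root_bound l q T s : packing l q -> uniq s -> run s l q T ->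
  T <= 1203/1000 * total s.
Proof.
move=> pk us r; have [q0 ql e _] := run_facts r.
have base : cost (perim_lb q) s <= total s.
  by apply: (cost_le_total pk q0) => k _; right; have [] := packing_dims k pk.
have adm := perim_lb_admissible q0.
have ft : fits (perim_lb q) l q by right; exact: perim_lb_truncated.
have fin : T <= 1203/1000 * cost (perim_lb q) s -> T <= 1203/1000 * total s.
  move=> h; apply: le_trans h _; rewrite ler_pM2l; first exact: base.
  by clear - A_gt0 X0 X1 Y0 Y1; lra.
have [gs|ng] := pselect (gapped A s); last exact: fin (nogap_le A_gt0 adm r ng ft).
have [] := gapped_trichotomy A_gt0 adm r gs ft (fun E _ => thin_wide_bound A_gt0 E).
- by move=> [i [E]]; exact: root_dominated.
- by move=> [i [v [j [E]]]]; exact: root_next_dominated.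
- exact: fin.
Qed.
End Root.

(** * Rectangles and executions *)

Section Rect.
Local Open Scope classical_set_scope.
Variable R : realType.
Implicit Types P Q : rect R.

Lemma width_gt0 Q : 0 < width Q.
Proof. by rewrite subr_gt0 left_lt_right. Qed.

Lemma height_gt0 Q : 0 < height Q.
Proof. by rewrite subr_gt0 bottom_lt_top. Qed.

Lemma pointsP Q (z : R * R) :
  points Q z <-> (left Q <= z.1 /\ z.1 <= right Q) /\ (bottom Q <= z.2 /\ z.2 <= top Q).
Proof.
rewrite /points /=; split.
  by move=> []; rewrite !in_itv /= => /andP[-> ->] /andP[-> ->].
by move=> [[a b] [c d]]; split; rewrite /= in_itv /= ?a ?b ?c ?d.
Qed.

Lemma interior_points Q (z : R * R) : (points Q)° z <->
  (left Q < z.1 /\ z.1 < right Q) /\ (bottom Q < z.2 /\ z.2 < top Q).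
Proof.
split.
- rewrite /interior => -[[U V] /= [Uz Vz]] UV.
  have [e e0 eU] : exists2 e, 0 < e & forall t, `|z.1 - t| < e -> U t.
    by move/nbhs_ballP : Uz => [e e0 eU]; exists e.
  have [d d0 dV] : exists2 d, 0 < d & forall t, `|z.2 - t| < d -> V t.
    by move/nbhs_ballP : Vz => [d d0 dV]; exists d.
  have hx t : `|z.1 - t| < e -> left Q <= t /\ t <= right Q.
    move=> /eU tU; have /UV /pointsP[] // : (U `*` V) (t, z.2).
    by split=> //=; apply: dV; rewrite subrr normr0.
  have hy t : `|z.2 - t| < d -> bottom Q <= t /\ t <= top Q.
    move=> /dV tV; have /UV /pointsP[] // : (U `*` V) (z.1, t).
    by split=> //=; apply: eU; rewrite subrr normr0.
  have [] := hx (z.1 - e / 2); first by rewrite opprB addrC subrK gtr0_norm; lra.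
  have [] := hx (z.1 + e / 2); first by rewrite opprD addrA subrr add0r normrN gtr0_norm; lra.
  have [] := hy (z.2 - d / 2); first by rewrite opprB addrC subrK gtr0_norm; lra.
  have [] := hy (z.2 + d / 2); first by rewrite opprD addrA subrr add0r normrN gtr0_norm; lra.
  by split; lra.
- move=> [[a b] [c d]]; exists (`[left Q, right Q]%classic, `[bottom Q, top Q]%classic) => //=.
  split.
    have : (`[left Q, right Q]%classic)° z.1 by rewrite interior_itv_bnd /= in_itv /= a b.
    exact.
  have : (`[bottom Q, top Q]%classic)° z.2 by rewrite interior_itv_bnd /= in_itv /= c d.
  exact.
Qed.

Definition inside P Q : Prop :=
  [/\ left Q <= left P, right P <= right Q, bottom Q <= bottom P & top P <= top Q].

Definition separated P Q : Prop :=
  (right P <= left Q \/ right Q <= left P) \/ (top P <= bottom Q \/ top Q <= bottom P).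

Lemma inside_trans P Q Q' : inside P Q -> inside Q Q' -> inside P Q'.
Proof.
by move=> [a b c d] [a' b' c' d']; split;
  [apply: le_trans a|apply: le_trans b'|apply: le_trans c|apply: le_trans d'].
Qed.

Lemma inside_points P Q : points P `<=` points Q <-> inside P Q.
Proof.
have lr := left_lt_right P; have bt := bottom_lt_top P; split.
  move=> h; have /pointsP[/= [h1 _] [h2 _]] : points Q (left P, bottom P).
    by apply: h; apply/pointsP => /=; rewrite !lexx !ltW.
  have /pointsP[/= [_ h3] [_ h4]] : points Q (right P, top P).
    by apply: h; apply/pointsP => /=; rewrite !lexx !ltW.
  by split.
by move=> [a b c d] z /pointsP [[x0 x1] [y0 y1]]; apply/pointsP; split; split; lra.
Qed.

Lemma separatedP P Q : separated P Q <-> (points P)° `&` (points Q)° = set0.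
Proof.
split.
  move=> h; rewrite -subset0 => z [/interior_points[[a b] [c d]] /interior_points[[a' b'] [c' d']]].
  by case: h => -[h|h]; lra.
move=> h; have lr := left_lt_right P; have bt := bottom_lt_top P.
have lr' := left_lt_right Q; have bt' := bottom_lt_top Q.
have [h1|h1] := leP (right P) (left Q); first by left; left.
have [h2|h2] := leP (right Q) (left P); first by left; right.
have [h3|h3] := leP (top P) (bottom Q); first by right; left.
have [h4|h4] := leP (top Q) (bottom P); first by right; right.
have mid a b a' b' : a < b -> a' < b' -> a < b' -> a' < b ->
    exists x : R, (a < x /\ x < b) /\ (a' < x /\ x < b').
  move=> ab ab' ab2 ab2'; exists ((Num.max a a' + Num.min b b') / 2).
  have : Num.max a a' < Num.min b b' by rewrite lt_min !gt_max ab ab2' ab' ab2.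
  have : a <= Num.max a a' by rewrite le_max lexx.
  have : a' <= Num.max a a' by rewrite le_max lexx orbT.
  have : Num.min b b' <= b by rewrite ge_min lexx.
  have : Num.min b b' <= b' by rewrite ge_min lexx orbT.
  by clear; lra.
have [x [xP xQ]] := mid _ _ _ _ lr lr' h2 h1; have [y [yP yQ]] := mid _ _ _ _ bt bt' h4 h3.
have : ((points P)° `&` (points Q)°) (x, y).
  by split; apply/interior_points.
by rewrite h.
Qed.

Lemma is_partition_inside (I : Type) Q (S : I -> rect R) :
  is_partition Q S -> forall i, inside (S i) Q.
Proof.
by move=> [cov _] i; apply/inside_points; rewrite -cov => z zi; exists i.
Qed.

Lemma is_partition_separated (I : eqType) Q (S : I -> rect R) i j :
  is_partition Q S -> i != j -> separated (S i) (S j).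
Proof.
move=> [_ /trivIsetP h] ij; apply/separatedP; exact: h.
Qed.

Lemma divide_dims Q Q1 Q2 a1 a2 q : divide Q Q1 Q2 -> area Q1 = a1 -> area Q2 = a2 ->
  q = Num.min (width Q) (height Q) ->
  [/\ inside Q1 Q /\ inside Q2 Q, separated Q1 Q2, area Q = a1 + a2,
      [/\ Num.max (width Q1) (height Q1) = Num.max (a1 / q) q,
          Num.min (width Q1) (height Q1) = Num.min (a1 / q) q,
          Num.max (width Q2) (height Q2) = Num.max (a2 / q) q &
          Num.min (width Q2) (height Q2) = Num.min (a2 / q) q] &
      forall z, points Q z -> points Q1 z \/ points Q2 z].
Proof.
move=> dv <- <- ->; have lr1 := left_lt_right Q1; have lr2 := left_lt_right Q2.
have bt1 := bottom_lt_top Q1; have bt2 := bottom_lt_top Q2.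
have w0 := width_gt0 Q; have h0 := height_gt0 Q.
move: dv; rewrite /divide; case: ltP => hw.
  move=> [l1 r1 r2 [b1 t1] [b2 t2]].
  have e1 : height Q1 = height Q by rewrite /height b1 t1.
  have e2 : height Q2 = height Q by rewrite /height b2 t2.
  split.
  - by split; split; lra.
  - by left; left; lra.
  - by rewrite /area e1 e2 -mulrDl /width; congr (_ * _); lra.
  - by rewrite /area e1 e2 !mulfK ?gt_eqF.
  - move=> z /pointsP[[x0 x1] [y0 y1]].
    by have [h|h] := leP z.1 (right Q1); [left|right]; apply/pointsP; split; split; lra.
move=> [t1 b1 b2 [l1 r1] [l2 r2]].
have e1 : width Q1 = width Q by rewrite /width l1 r1.
have e2 : width Q2 = width Q by rewrite /width l2 r2.
split.
- by split; split; lra.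
- by right; right; lra.
- by rewrite /area e1 e2 -mulrDr /height; congr (_ * _); lra.
- rewrite /area e1 e2 ![width Q * _]mulrC !mulfK ?gt_eqF //.
  by rewrite !(maxC (width Q)) !(minC (width Q)).
- move=> z /pointsP[[x0 x1] [y0 y1]].
  by have [h|h] := leP z.2 (top Q2); [right|left]; apply/pointsP; split; split; lra.
Qed.

Lemma divide_exists Q a1 a2 : 0 < a1 -> 0 < a2 -> area Q = a1 + a2 ->
  exists Q1 Q2, [/\ divide Q Q1 Q2, area Q1 = a1 & area Q2 = a2].
Proof.
move=> a10 a20 e; have w0 := width_gt0 Q; have h0 := height_gt0 Q.
have [hw|/negPf hw] := boolP (height Q < width Q).
  have d0 : 0 < a1 / height Q by rewrite divr_gt0.
  have d1 : 0 < a2 / height Q by rewrite divr_gt0.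
  have we : width Q = a1 / height Q + a2 / height Q.
    by rewrite -mulrDl -e mulfK // gt_eqF.
  have l1 : left Q < left Q + a1 / height Q by lra.
  have l2 : left Q + a1 / height Q < right Q by move: we; rewrite /width; lra.
  exists (Rect l1 (bottom_lt_top Q)), (Rect l2 (bottom_lt_top Q)); split;
    first by rewrite /divide hw.
    by rewrite /area /width /height /= addrAC subrr add0r divfK // gt_eqF.
  rewrite /area; have -> : width (Rect l2 (bottom_lt_top Q)) = a2 / height Q.
    by move: we; rewrite /width /=; lra.
  by rewrite divfK // gt_eqF.
have d0 : 0 < a1 / width Q by rewrite divr_gt0.
have d1 : 0 < a2 / width Q by rewrite divr_gt0.
have he : height Q = a1 / width Q + a2 / width Q.
  by rewrite -mulrDl -e /area [width Q * _]mulrC mulfK // gt_eqF.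
have l1 : top Q - a1 / width Q < top Q by lra.
have l2 : bottom Q < top Q - a1 / width Q by move: he; rewrite /height; lra.
exists (Rect (left_lt_right Q) l1), (Rect (left_lt_right Q) l2); split;
    first by rewrite /divide hw.
  rewrite /area; have -> : height (Rect (left_lt_right Q) l1) = a1 / width Q.
    by rewrite /height /=; lra.
  by rewrite mulrC divfK // gt_eqF.
rewrite /area; have -> : height (Rect (left_lt_right Q) l2) = a2 / width Q.
  by move: he; rewrite /height /=; lra.
by rewrite mulrC divfK // gt_eqF.
Qed.
End Rect.

(** * Executions: correctness, cost and existence *)

Section Execution.
Variables (R : realType) (I : eqType) (A : I -> R).
Hypothesis A_gt0 : forall i, 0 < A i.
Implicit Types (P Q : rect R) (s : seq I) (f g : I -> rect R).
Local Notation ar := (block_area A).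

Lemma separated_inside P P' Q Q' : separated P Q -> inside P' P -> inside Q' Q ->
  separated P' Q'.
Proof.
move=> h [a b c d] [a' b' c' d']; case: h => -[h|h].
- by left; left; apply: le_trans b (le_trans h a').
- by left; right; apply: le_trans b' (le_trans h a).
- by right; left; apply: le_trans d (le_trans h c').
- by right; right; apply: le_trans d' (le_trans h c).
Qed.

Lemma separated_sym P Q : separated P Q -> separated Q P.
Proof. by case=> -[h|h]; [left; right|left; left|right; right|right; left]. Qed.

Lemma Partition_facts f Q s : Partition A f Q s -> sorted_areas A s -> area Q = ar s ->
  [/\ run A s (Num.max (width Q) (height Q)) (Num.min (width Q) (height Q))
          (\sum_(i <- s) perim (f i)),
      forall i, i \in s -> area (f i) = A i /\ inside (f i) Q,
      forall i j, i \in s -> j \in s -> i != j -> separated (f i) (f j) &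
      forall z, points Q z -> exists2 i, i \in s & points (f i) z].
Proof.
elim=> {Q s} [Q i <- _|Q Q1 Q2 s s1 s2 mg dv a1 a2 _ IH1 _ IH2 ss e].
  rewrite block_area_seq1 => e; split.
  - rewrite big_seq1 /perim -(addr_max_min (width _)); constructor.
    + by rewrite lt_min width_gt0 height_gt0.
    + exact: min_le_max.
    + rewrite -e /area; have /orP[h|h] := le_total (width (f i)) (height (f i)).
        by rewrite max_r // min_l // mulrC.
      by rewrite max_l // min_r.
  - by move=> j; rewrite inE => /eqP->.
  - by move=> j k; rewrite !inE => /eqP-> /eqP->; rewrite eqxx.
  - by move=> z zi; exists i; rewrite ?mem_head.
have sp := split_of_merge A_gt0 ss mg; have [ps _ [ss1 ss2] _ _] := sp.
have [[in1 in2] sep _ [M1 m1 M2 m2] cov] := divide_dims dv a1 a2 erefl.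
have [r1 f1 d1 c1] := IH1 ss1 a1; have [r2 f2 d2 c2] := IH2 ss2 a2.
have mem i : (i \in s) = (i \in s1) || (i \in s2) by rewrite (perm_mem ps) mem_cat.
split.
- rewrite (perm_big _ ps) big_cat /=; apply: RunSplit sp _ _.
  + by rewrite lt_min width_gt0 height_gt0.
  + exact: min_le_max.
  + rewrite -e /area; have /orP[h|h] := le_total (width Q) (height Q).
      by rewrite max_r // min_l // mulrC.
    by rewrite max_l // min_r.
  + by rewrite -M1 -m1.
  + by rewrite -M2 -m2.
- move=> i; rewrite mem => /orP[/f1|/f2] [-> h]; split=> //.
    exact: inside_trans in1.
  exact: inside_trans in2.
- have s12 i j : i \in s1 -> j \in s2 -> separated (f i) (f j).
    by move=> /f1[_ h] /f2[_ h']; apply: separated_inside sep h h'.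
  move=> i j; rewrite !mem => /orP[i1|i2] /orP[j1|j2] ij.
  + exact: d1.
  + exact: s12.
  + by apply: separated_sym; exact: s12.
  + exact: d2.
- move=> z /cov [/c1|/c2] [i si zi]; exists i => //; rewrite mem si ?orbT //.
Qed.

(** Used to glue the assignments obtained separately for the two halves into one function. *)
Lemma eq_Partition f g Q s : Partition A f Q s -> sorted_areas A s ->
  {in s, f =1 g} -> Partition A g Q s.
Proof.
elim=> {Q s} [Q i fi _ fg|Q Q1 Q2 s s1 s2 mg dv a1 a2 _ IH1 _ IH2 ss fg].
  by constructor; rewrite -fg ?mem_head.
have [ps _ [ss1 ss2] _ _] := split_of_merge A_gt0 ss mg.
apply: PartitionSplit mg dv a1 a2 _ _.
  by apply: IH1 => // i si; apply: fg; rewrite (perm_mem ps) mem_cat si.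
by apply: IH2 => // i si; apply: fg; rewrite (perm_mem ps) mem_cat si orbT.
Qed.

Lemma insert_block (bs : seq (seq I)) c : sorted_blocks A bs ->
  exists bs1 bs2, bs = bs1 ++ bs2 /\ sorted_blocks A (bs1 ++ c :: bs2).
Proof.
have tr : transitive (fun b c : seq I => ar c <= ar b).
  by move=> y x z yx zy; exact: le_trans zy yx.
rewrite /sorted_blocks; elim: bs => [|b bs IH]; first by exists [::], [::].
rewrite (sorted_pairwise tr) /= => /andP[hb]; rewrite -(sorted_pairwise tr) => sb.
have [bc|cb] := leP (ar b) (ar c).
  by exists [::], (b :: bs); split=> //=; rewrite bc /= path_sortedE // hb.
have [bs1 [bs2 [e s12]]] := IH sb; exists (b :: bs1), bs2; split; first by rewrite e.
rewrite /= path_sortedE // s12 andbT; move: hb; rewrite e !all_cat /= (ltW cb).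
by move=> /andP[-> ->].
Qed.

Lemma merge_blocks_exists (bs : seq (seq I)) : sorted_blocks A bs -> (1 < size bs)%N ->
  exists s1 s2, merge_blocks A bs s1 s2.
Proof.
have [n] := ubnP (size bs); elim: n bs => // n IH bs; rewrite ltnS => sn sb s2.
case/lastP: bs sn sb s2 => // bs b2; case/lastP: bs => // bs b1 sn sb _.
have E : rcons (rcons bs b1) b2 = bs ++ [:: b1; b2] by rewrite -!cats1 -catA.
rewrite E in sn sb *; case: bs E sn sb => [|b bs] _ sn sb.
  by exists b1, b2; constructor.
set bs' := b :: bs in sn sb *.
have tr : transitive (fun b c : seq I => ar c <= ar b).
  by move=> y x z yx zy; exact: le_trans zy yx.
have sb' : sorted_blocks A bs'.
  by move: sb; rewrite /sorted_blocks !(sorted_pairwise tr) pairwise_cat => /and3P[].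
pose c := path.sort (fun i j => A j <= A i) (b1 ++ b2).
have [bs1 [bs2 [e sc]]] := insert_block c sb'.
have sz : (size (bs1 ++ c :: bs2) = (size bs').+1)%N.
  by rewrite e !size_cat /= addnS.
have [|//|s1 [s2 mg]] := IH (bs1 ++ c :: bs2) _ sc.
- by rewrite sz; move: sn; rewrite size_cat /= addn2.
- by rewrite sz.
exists s1, s2; rewrite e -catA; apply: (@MergeStep _ _ _ _ _ _ _ c) => //.
- by rewrite -e.
- by rewrite /c perm_sort.
- by apply: sort_sorted => x y; exact: le_total.
Qed.

Lemma Partition_exists s Q : s != [::] -> uniq s -> sorted_areas A s -> area Q = ar s ->
  exists f, Partition A f Q s.
Proof.
have [n] := ubnP (size s); elim: n s Q => // n IH s Q; rewrite ltnS => sn n0 us ss e.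
have [s1|s1] := leqP (size s) 1.
  case: s n0 s1 {sn us ss e} => [|i []] // _ _.
  by exists (fun=> Q); constructor.
have sb : sorted_blocks A [seq [:: i] | i <- s].
  rewrite /sorted_blocks sorted_map; apply: sub_sorted ss => i j /=.
  by rewrite !block_area_seq1.
have [t1 [t2 mg]] : exists s1 s2, merge_blocks A [seq [:: i] | i <- s] s1 s2.
  by apply: merge_blocks_exists; rewrite ?size_map.
have sp := split_of_merge A_gt0 ss mg; have [z1 z2 z] := split_sizes sp.
have [ps [n1 n2] [ss1 ss2] _ _] := sp; have [a10 a20 ea] := split_areas A_gt0 sp.
have := perm_uniq ps; rewrite us cat_uniq => /esym/and3P[u1 /hasPn dj u2].
have [Q1 [Q2 [dv a1 a2]]] := divide_exists a10 a20 (etrans e ea).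
have [f1 p1] : exists f, Partition A f Q1 t1.
  by apply: IH => //; apply: leq_trans sn; rewrite z -[X in (X < _)%N]addn0 ltn_add2l.
have [f2 p2] : exists f, Partition A f Q2 t2.
  by apply: IH => //; apply: leq_trans sn; rewrite z -[X in (X < _)%N]add0n ltn_add2r.
exists (fun i => if i \in t1 then f1 i else f2 i).
apply: PartitionSplit mg dv a1 a2 _ _.
  by apply: eq_Partition p1 ss1 _ => i ->.
by apply: eq_Partition p2 ss2 _ => i /dj /negPf /= ->.
Qed.
End Execution.

(** * Coordinates of a competing partition, and the approximation theorem *)

Lemma packing_of_partition (R : realType) (I : eqType) (A : I -> R) (Q : rect R)
    (S : I -> rect R) : is_partition Q S -> (forall i, area (S i) = A i) ->
  exists X0 X1 Y0 Y1 : I -> R,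
    packing A X0 X1 Y0 Y1 (Num.max (width Q) (height Q)) (Num.min (width Q) (height Q)) /\
    forall i, (X1 i - X0 i) + (Y1 i - Y0 i) = perim (S i).
Proof.
move=> pS aS; have ins := is_partition_inside pS.
have sep i j := @is_partition_separated R I Q S i j pS.
have /orP[h|h] := le_total (height Q) (width Q).
  exists (fun i => left (S i) - left Q), (fun i => right (S i) - left Q),
    (fun i => bottom (S i) - bottom Q), (fun i => top (S i) - bottom Q).
  rewrite max_l // min_r //; split; last first.
    by move=> i; rewrite /perim /width /height; lra.
  split.
  - move=> i; have [a b c d] := ins i; have lr := left_lt_right (S i).
    by rewrite /width; split; lra.
  - move=> i; have [a b c d] := ins i; have bt := bottom_lt_top (S i).
    by rewrite /height; split; lra.
  - by move=> i; rewrite -aS /area /width /height; congr (_ * _); lra.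
  - move=> i j /sep; rewrite /separated => -[] [k|k];
    [left; left|left; right|right; left|right; right]; lra.
(* In a rectangle that is at least as high as wide the axes are exchanged, so that the first
   coordinate runs along the long side. *)
exists (fun i => bottom (S i) - bottom Q), (fun i => top (S i) - bottom Q),
  (fun i => left (S i) - left Q), (fun i => right (S i) - left Q).
rewrite max_r // min_l //; split; last first.
  by move=> i; rewrite /perim /width /height; lra.
split.
- move=> i; have [a b c d] := ins i; have bt := bottom_lt_top (S i).
  by rewrite /height; split; lra.
- move=> i; have [a b c d] := ins i; have lr := left_lt_right (S i).
  by rewrite /width; split; lra.
- by move=> i; rewrite -aS /area mulrC /width /height; congr (_ * _); lra.
- move=> i j /sep; rewrite /separated => -[] [k|k];
  [right; left|right; right|left; left|left; right]; lra.
Qed.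

Theorem theorem1 (R : realType) (n : nat) (A : 'I_n -> R) (Q : rect R)
    (n_ge1 : (1 <= n)%N) (A_gt0 : forall i : 'I_n, 0 < A i)
    (area_Q : area Q = \sum_(i < n) A i) :
  (exists f : 'I_n -> rect R, ApproximationDC A Q f) /\
  (forall f : 'I_n -> rect R, ApproximationDC A Q f ->
     [/\ is_partition Q f,
         forall i : 'I_n, area (f i) = A i &
         forall S : 'I_n -> rect R,
           is_partition Q S -> (forall i : 'I_n, area (S i) = A i) ->
           \sum_(i < n) perim (f i)
             <= 1203%:R / 1000%:R * \sum_(i < n) perim (S i)]).
Proof.
have sumE (F : 'I_n -> R) s : perm_eq s (enum 'I_n) -> \sum_(i < n) F i = \sum_(i <- s) F i.
  by move=> ps; rewrite (perm_big _ ps) big_enum.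
split.
  pose s := path.sort (fun i j => A j <= A i) (enum 'I_n).
  have ps : perm_eq s (enum 'I_n) by rewrite perm_sort.
  have ss : sorted_areas A s by apply: sort_sorted => x y; exact: le_total.
  have n0 : s != [::].
    by rewrite -size_eq0 (perm_size ps) size_enum_ord -lt0n.
  have us : uniq s by rewrite (perm_uniq ps) enum_uniq.
  have [f pf] : exists f, Partition A f Q s.
    by apply: Partition_exists => //; rewrite area_Q; exact: sumE.
  by exists f, s.
move=> f [s [ps ss pf]]; have sQ : area Q = block_area A s by rewrite area_Q; exact: sumE.
have mem i : i \in s by rewrite (perm_mem ps) mem_enum.
have us : uniq s by rewrite (perm_uniq ps) enum_uniq.
have [r fa sep cov] := Partition_facts A_gt0 pf ss sQ; split.
- split.
    apply/seteqP; split=> z.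
      by move=> [i _]; apply: (inside_points (f i) Q).2; have [] := fa i (mem i).
    by move=> /cov [i _ zi]; exists i.
  by apply/trivIsetP => i j _ _ ij; apply/separatedP; exact: sep.
- by move=> i; have [] := fa i (mem i).
- move=> S pS aS.
  have [X0 [X1 [Y0 [Y1 [pk pE]]]]] := packing_of_partition pS aS.
  have := root_bound A_gt0 pk us r; rewrite /total.
  rewrite [X in _ <= _ * X](eq_bigr (fun i => perim (S i))) => [|i _]; last exact: pE.
  by rewrite !(sumE _ s ps).
Qed.
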